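(* Let $X$ be a Hilbert space and let $T:X\rightrightarrows X$ be a proper set-valued mapping with norm-closed graph. Then the following are equivalent: (i) $T$ is maximal monotone on $X$; (ii) $T$ is hypomonotone on $X$ and for every $(u,v)\in\operatorname{gph}T$ one has $\langle z,w\rangle\ge0$ whenever $w\in X$ and $z\in D^*_MT(u,v)(w)$. Moreover, if $\operatorname{dom}T$ is convex, the equivalence remains true when the hypomonotonicity of $T$ on $X$ in (ii) is replaced by semilocal hypomonotonicity of $T$ on $X$.
   Context: $X$ is a real Hilbert space identified with its dual. For $T:X\rightrightarrows X$: $\operatorname{dom}T$, $\operatorname{gph}T$ as usual; proper means nonempty domain. Monotone: $\langle v_1-v_2,u_1-u_2\rangle\ge0$ on $\operatorname{gph}T$; maximal monotone: monotone with graph not properly contained in that of another monotone mapping. Hypomonotone on $X$: exists $r>0$ with $\langle v_1-v_2,u_1-u_2\rangle\ge -r\|u_1-u_2\|^2$ on $\operatorname{gph}T$. Semilocally hypomonotone on $X$: for each $\bar u\in\operatorname{dom}T$ there are a neighborhood $U$ of $\bar u$ and $r>0$ with the same inequality for all pairs in $\operatorname{gph}T\cap(U\times X)$. Regular normal cone: $\widehat N(\bar p;\Omega)=\{q:\limsup_{p\to\bar p,\,p\in\Omega}\langle q,p-\bar p\rangle/\|p-\bar p\|\le0\}$; regular coderivative $\widehat D^*T(u,v)(w)=\{z:(z,-w)\in\widehat N((u,v);\operatorname{gph}T)\}$. Mixed limiting coderivative: $z\in D^*_MT(\bar u,\bar v)(w)$ iff there exist sequences $(u_k,v_k)\in\operatorname{gph}T$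 with $(u_k,v_k)\to(\bar u,\bar v)$ in norm, $w_k\to w$ in norm, and $z_k\to z$ weakly, with $z_k\in\widehat D^*T(u_k,v_k)(w_k)$ for all $k$. *)

(* Defs.v *)
From Stdlib Require Import Reals Lra.
Open Scope R_scope.

Record Hilbert := {
  hcar :> Type;
  hzero : hcar;
  hadd : hcar -> hcar -> hcar;
  hopp : hcar -> hcar;
  hscal : R -> hcar -> hcar;
  hinner : hcar -> hcar -> R;
  hadd_assoc : forall x y z, hadd x (hadd y z) = hadd (hadd x y) z;
  hadd_comm : forall x y, hadd x y = hadd y x;
  hadd_zero : forall x, hadd x hzero = x;
  hadd_opp : forall x, hadd x (hopp x) = hzero;
  hscal_one : forall x, hscal 1 x = x;
  hscal_assoc : forall a b x, hscal a (hscal b x) = hscal (a * b) x;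
  hscal_distr_l : forall a x y, hscal a (hadd x y) = hadd (hscal a x) (hscal a y);
  hscal_distr_r : forall a b x, hscal (a + b) x = hadd (hscal a x) (hscal b x);
  hinner_sym : forall x y, hinner x y = hinner y x;
  hinner_add_l : forall x y z, hinner (hadd x y) z = hinner x z + hinner y z;
  hinner_scal_l : forall a x y, hinner (hscal a x) y = a * hinner x y;
  hinner_pos : forall x, 0 <= hinner x x;
  hinner_def : forall x, hinner x x = 0 -> x = hzero;
  hcomplete : forall u : nat -> hcar,
    (forall eps, eps > 0 -> exists N, forall m n, (m >= N)%nat -> (n >= N)%nat ->
        sqrt (hinner (hadd (u m) (hopp (u n))) (hadd (u m) (hopp (u n)))) < eps) ->
    exists l, forall eps, eps > 0 -> exists N, forall n, (n >= N)%nat ->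
        sqrt (hinner (hadd (u n) (hopp l)) (hadd (u n) (hopp l))) < eps
}.

Arguments hzero {_}. Arguments hadd {_}. Arguments hopp {_}.
Arguments hscal {_}. Arguments hinner {_}.

Section HilbertDefs.
Variable X : Hilbert.

Definition hsub (x y : X) : X := hadd x (hopp y).
Definition hnorm (x : X) : R := sqrt (hinner x x).

Definition ncv (u : nat -> X) (l : X) : Prop :=
  forall eps, eps > 0 -> exists N, forall n, (n >= N)%nat -> hnorm (hsub (u n) l) < eps.

(** Weak convergence in X (X identified with its dual, Riesz). *)
Definition wcv (u : nat -> X) (l : X) : Prop :=
  forall x : X, Un_cv (fun n => hinner (u n) x) (hinner l x).

(** Set-valued mappings T : X ⇉ X, given by their graph: T u v  <->  v ∈ T(u). *)
Definition setmap := X -> X -> Prop.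

Definition dom (T : setmap) (u : X) : Prop := exists v, T u v.

Definition proper (T : setmap) : Prop := exists u, dom T u.

(** Norm-closed graph (X×X is a metric space, so sequential closedness). *)
Definition closed_graph (T : setmap) : Prop :=
  forall (u v : nat -> X) (ub vb : X),
    (forall k, T (u k) (v k)) -> ncv u ub -> ncv v vb -> T ub vb.

Definition monotone (T : setmap) : Prop :=
  forall u1 v1 u2 v2, T u1 v1 -> T u2 v2 ->
    0 <= hinner (hsub v1 v2) (hsub u1 u2).

Definition maximal_monotone (T : setmap) : Prop :=
  monotone T /\
  forall S : setmap, monotone S -> (forall u v, T u v -> S u v) ->
    forall u v, S u v -> T u v.

Definition hypomonotone (T : setmap) : Prop :=
  exists r, r > 0 /\ forall u1 v1 u2 v2, T u1 v1 -> T u2 v2 ->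
    hinner (hsub v1 v2) (hsub u1 u2) >= - r * (hnorm (hsub u1 u2))^2.

(** Semilocal hypomonotonicity; neighborhoods of ubar are taken to be
    open balls (every neighborhood contains one, and the property is
    inherited by smaller neighborhoods). *)
Definition semilocally_hypomonotone (T : setmap) : Prop :=
  forall ub, dom T ub ->
    exists delta r, delta > 0 /\ r > 0 /\
      forall u1 v1 u2 v2,
        hnorm (hsub u1 ub) < delta -> hnorm (hsub u2 ub) < delta ->
        T u1 v1 -> T u2 v2 ->
        hinner (hsub v1 v2) (hsub u1 u2) >= - r * (hnorm (hsub u1 u2))^2.

Definition pinner (p q : X * X) : R :=
  hinner (fst p) (fst q) + hinner (snd p) (snd q).
Definition psub (p q : X * X) : X * X := (hsub (fst p) (fst q), hsub (snd p) (snd q)).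
Definition pnorm (p : X * X) : R := sqrt (pinner p p).

(** Regular (Fréchet) normal cone to Omega ⊆ X×X at pb:
    limsup_{p -> pb, p ∈ Omega} <q, p - pb>/||p - pb|| <= 0. *)
Definition reg_normal (Omega : X * X -> Prop) (pb q : X * X) : Prop :=
  forall eps, eps > 0 -> exists delta, delta > 0 /\
    forall p, Omega p -> 0 < pnorm (psub p pb) < delta ->
      pinner q (psub p pb) / pnorm (psub p pb) <= eps.

Definition gph (T : setmap) (p : X * X) : Prop := T (fst p) (snd p).

Definition reg_coderiv (T : setmap) (u v w z : X) : Prop :=
  reg_normal (gph T) (u, v) (z, hopp w).

Definition mixed_coderiv (T : setmap) (ub vb w z : X) : Prop :=
  exists (u v wk zk : nat -> X),
    (forall k, T (u k) (v k)) /\ ncv u ub /\ ncv v vb /\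
    ncv wk w /\ wcv zk z /\
    (forall k, reg_coderiv T (u k) (v k) (wk k) (zk k)).

Definition convex (C : X -> Prop) : Prop :=
  forall x y t, C x -> C y -> 0 <= t <= 1 ->
    C (hadd (hscal (1 - t) x) (hscal t y)).

Definition coderiv_psd (T : setmap) : Prop :=
  forall u v, T u v -> forall w z, mixed_coderiv T u v w z -> 0 <= hinner z w.

End HilbertDefs.

Arguments hsub {_}. Arguments hnorm {_}.

(* Main.v *)
(** Weakly convergent sequences are bounded, so nonnegativity of the mixed coderivative reduces
    to nonnegativity of the regular one.

    If [T] is maximal monotone, then [I + T] is onto by Minty's theorem (obtained here by
    minimizing the Fitzpatrick function plus half the squared norm). If a regular normal
    [(z, - w)] to the graph had [<z, w> < 0], moving [u + v] in the direction [z - w] would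
    contradict it, since [|du - dv| <= |du + dv|] on the graph.

    Conversely, a failure of monotonicity together with hypomonotonicity yields, through the
    Borwein-Preiss principle applied in the coordinate [s u + v] of the graph with [s] large,
    a regular normal with [<z, w> < 0]; so [T] is monotone. The same principle applied to the
    squared distance from [y] to the range of [I + T] shows that this distance is [0], and the
    range is closed; so [I + T] is onto and [T] is maximal. In the semilocal case this local
    argument gives [<dv, du> >= - th |du|^2] for nearby points of a segment in [dom T] and every
    [th > 0]; these inequalities add up along the segment. *)

Require Import Defs.
From Stdlib Require Import Reals Lra Lia Psatz Classical IndefiniteDescription.
Open Scope R_scope.

Local Infix "[+]" := hadd (at level 50, left associativity).
Local Infix "[-]" := hsub (at level 50, left associativity).
Local Infix "[*]" := hscal (at level 40, left associativity).
Local Notation "<< x , y >>" := (hinner x y) (at level 0).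

(** * Inner products and norms *)

Lemma inner_add_r {X : Hilbert} (x y z : X) : <<x, y [+] z>> = <<x, y>> + <<x, z>>.
Proof. rewrite hinner_sym, hinner_add_l, (hinner_sym X y), (hinner_sym X z). ring. Qed.

Lemma inner_scal_r {X : Hilbert} (a : R) (x y : X) : <<x, a [*] y>> = a * <<x, y>>.
Proof. rewrite hinner_sym, hinner_scal_l, (hinner_sym X y). ring. Qed.

Lemma inner_zero_l {X : Hilbert} (x : X) : <<hzero, x>> = 0.
Proof. generalize (hinner_add_l X hzero hzero x). rewrite hadd_zero. lra. Qed.

Lemma inner_zero_r {X : Hilbert} (x : X) : <<x, hzero>> = 0.
Proof. rewrite hinner_sym. apply inner_zero_l. Qed.

Lemma inner_opp_l {X : Hilbert} (x y : X) : <<hopp x, y>> = - <<x, y>>.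
Proof.
  generalize (hinner_add_l X x (hopp x) y). rewrite hadd_opp, inner_zero_l. lra.
Qed.

Lemma inner_opp_r {X : Hilbert} (x y : X) : <<x, hopp y>> = - <<x, y>>.
Proof. rewrite hinner_sym, inner_opp_l, hinner_sym. reflexivity. Qed.

Lemma inner_sub_l {X : Hilbert} (x y z : X) : <<x [-] y, z>> = <<x, z>> - <<y, z>>.
Proof. unfold hsub. rewrite hinner_add_l, inner_opp_l. ring. Qed.

Lemma inner_sub_r {X : Hilbert} (x y z : X) : <<x, y [-] z>> = <<x, y>> - <<x, z>>.
Proof. unfold hsub. rewrite inner_add_r, inner_opp_r. ring. Qed.

Ltac expand_inner :=
  rewrite ?hinner_add_l, ?inner_add_r, ?inner_sub_l, ?inner_sub_r, ?hinner_scal_l,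
    ?inner_scal_r, ?inner_opp_l, ?inner_opp_r, ?inner_zero_l, ?inner_zero_r.

(** [ring] takes [<<a, b>>] and [<<b, a>>] for different atoms; whenever both occur, one is
    rewritten into the other. *)
Ltac order_inner :=
  repeat match goal with
  | |- context [hinner ?a ?b] =>
      match goal with
      | |- context [hinner b a] =>
          tryif constr_eq a b then fail else rewrite (hinner_sym _ b a)
      end
  end.

Ltac inner_ring := repeat progress expand_inner; order_inner; ring.

Lemma inner_ext {X : Hilbert} (x y : X) : (forall w, <<x, w>> = <<y, w>>) -> x = y.
Proof.
  intro E.
  assert (Z : x [-] y = hzero).
  { apply hinner_def. rewrite inner_sub_l, E. ring. }
  rewrite <- (hadd_zero X x), <- (hadd_opp X y), (hadd_comm X y), hadd_assoc.
  unfold hsub in Z. rewrite Z, hadd_comm. apply hadd_zero.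
Qed.

Ltac vec_ring := apply inner_ext; intro; inner_ring.

Lemma sub_eq_zero {X : Hilbert} (x y : X) : <<x [-] y, x [-] y>> = 0 -> x = y.
Proof.
  intro E. apply hinner_def in E. apply inner_ext. intro w.
  generalize (inner_sub_l x y w). rewrite E, inner_zero_l. lra.
Qed.

Lemma norm_nonneg {X : Hilbert} (x : X) : 0 <= hnorm x.
Proof. apply sqrt_pos. Qed.

Lemma norm_sqr {X : Hilbert} (x : X) : hnorm x * hnorm x = <<x, x>>.
Proof. apply sqrt_sqrt, hinner_pos. Qed.

Lemma norm_le {X : Hilbert} (x : X) (c : R) : 0 <= c -> <<x, x>> <= c * c -> hnorm x <= c.
Proof. intros Hc H. rewrite <- norm_sqr in H. apply Rsqr_incr_0_var; assumption. Qed.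

Lemma norm_pos {X : Hilbert} (x : X) : 0 < <<x, x>> -> 0 < hnorm x.
Proof. apply sqrt_lt_R0. Qed.

Lemma cauchy_schwarz_sqr {X : Hilbert} (x y : X) :
  <<x, y>> * <<x, y>> <= <<x, x>> * <<y, y>>.
Proof.
  destruct (Req_dec <<y, y>> 0) as [Hy | Hy].
  - apply hinner_def in Hy. subst y. rewrite !inner_zero_r. lra.
  - assert (P := hinner_pos X y).
    assert (Q := hinner_pos X (<<y, y>> [*] x [-] <<x, y>> [*] y)).
    replace <<<<y, y>> [*] x [-] <<x, y>> [*] y, <<y, y>> [*] x [-] <<x, y>> [*] y>>
      with (<<y, y>> * (<<x, x>> * <<y, y>> - <<x, y>> * <<x, y>>)) in Q by inner_ring.
    nra.
Qed.

Lemma cauchy_schwarz {X : Hilbert} (x y : X) : Rabs <<x, y>> <= hnorm x * hnorm y.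
Proof.
  apply Rsqr_incr_0_var.
  - rewrite <- Rsqr_abs. unfold Rsqr.
    replace (hnorm x * hnorm y * (hnorm x * hnorm y)) with (<<x, x>> * <<y, y>>)
      by (rewrite <- !norm_sqr; ring).
    apply cauchy_schwarz_sqr.
  - apply Rmult_le_pos; apply norm_nonneg.
Qed.

Lemma inner_le {X : Hilbert} (x y : X) : <<x, y>> <= hnorm x * hnorm y.
Proof. eapply Rle_trans; [apply Rle_abs | apply cauchy_schwarz]. Qed.

Lemma inner_ge {X : Hilbert} (x y : X) : - (hnorm x * hnorm y) <= <<x, y>>.
Proof.
  assert (H := cauchy_schwarz x y). unfold Rabs in H. destruct (Rcase_abs _); lra.
Qed.

Lemma norm_triangle {X : Hilbert} (x y : X) : hnorm (x [+] y) <= hnorm x + hnorm y.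
Proof.
  apply norm_le.
  - generalize (norm_nonneg x) (norm_nonneg y). lra.
  - expand_inner. rewrite (hinner_sym X y x), <- !norm_sqr. generalize (inner_le x y). lra.
Qed.

Lemma norm_scal {X : Hilbert} (a : R) (x : X) : hnorm (a [*] x) = Rabs a * hnorm x.
Proof.
  unfold hnorm. rewrite hinner_scal_l, inner_scal_r, <- Rmult_assoc.
  rewrite sqrt_mult_alt by apply Rle_0_sqr. f_equal. apply sqrt_Rsqr_abs.
Qed.

Lemma norm_zero {X : Hilbert} : hnorm (hzero : X) = 0.
Proof. unfold hnorm. rewrite inner_zero_l. apply sqrt_0. Qed.

Lemma norm_sub_sym {X : Hilbert} (x y : X) : hnorm (x [-] y) = hnorm (y [-] x).
Proof. unfold hnorm. f_equal. inner_ring. Qed.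

Lemma norm_sub_triangle {X : Hilbert} (x y z : X) :
  hnorm (x [-] z) <= hnorm (x [-] y) + hnorm (y [-] z).
Proof. replace (x [-] z) with ((x [-] y) [+] (y [-] z)) by vec_ring. apply norm_triangle. Qed.

(** * Convergence *)

Lemma Un_cv_const (c : R) : Un_cv (fun _ => c) c.
Proof. intros e He. exists 0%nat. intros n _. rewrite Rdist_eq. exact He. Qed.

Lemma Un_cv_0 (f g : nat -> R) : (forall n, Rabs (f n) <= g n) -> Un_cv g 0 -> Un_cv f 0.
Proof.
  intros H Hg e He. destruct (Hg e He) as [N HN]. exists N. intros n Hn.
  specialize (HN n Hn). unfold Rdist in *. rewrite Rminus_0_r in *.
  eapply Rle_lt_trans; [apply H |]. eapply Rle_lt_trans; [apply Rle_abs | exact HN].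
Qed.

Lemma Un_cv_scal_0 (c : R) (f : nat -> R) : Un_cv f 0 -> Un_cv (fun n => c * f n) 0.
Proof.
  intro H. replace 0 with (c * 0) by ring. apply CV_mult; [apply Un_cv_const | exact H].
Qed.

Lemma ncv_norm {X : Hilbert} (x : nat -> X) (l : X) :
  ncv X x l <-> Un_cv (fun n => hnorm (x n [-] l)) 0.
Proof.
  split; intros H e He; destruct (H e He) as [N HN]; exists N; intros n Hn;
    specialize (HN n Hn); unfold Rdist in *; rewrite Rminus_0_r in *;
    rewrite Rabs_pos_eq in * by apply norm_nonneg; exact HN.
Qed.

Lemma ncv_of_bound {X : Hilbert} (x : nat -> X) (l : X) (g : nat -> R) :
  (forall n, hnorm (x n [-] l) <= g n) -> Un_cv g 0 -> ncv X x l.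
Proof.
  intros H Hg. apply ncv_norm. apply Un_cv_0 with (2 := Hg). intro n.
  rewrite Rabs_pos_eq by apply norm_nonneg. apply H.
Qed.

Lemma ncv_const {X : Hilbert} (x : X) : ncv X (fun _ => x) x.
Proof.
  apply ncv_of_bound with (g := fun _ => 0); [intros _ | apply Un_cv_const].
  replace (x [-] x) with (hzero : X) by vec_ring. rewrite norm_zero. lra.
Qed.

Lemma ncv_add {X : Hilbert} (x y : nat -> X) (a b : X) :
  ncv X x a -> ncv X y b -> ncv X (fun n => x n [+] y n) (a [+] b).
Proof.
  rewrite !ncv_norm. intros Hx Hy.
  apply ncv_norm, ncv_of_bound with (g := fun n => hnorm (x n [-] a) + hnorm (y n [-] b)).
  - intro n. replace (x n [+] y n [-] (a [+] b)) with ((x n [-] a) [+] (y n [-] b)) by vec_ring.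
    apply norm_triangle.
  - replace 0 with (0 + 0) by ring. apply CV_plus; assumption.
Qed.

Lemma ncv_scal {X : Hilbert} (c : R) (x : nat -> X) (a : X) :
  ncv X x a -> ncv X (fun n => c [*] x n) (c [*] a).
Proof.
  rewrite !ncv_norm. intros Hx.
  apply ncv_norm, ncv_of_bound with (g := fun n => Rabs c * hnorm (x n [-] a)).
  - intro n. replace (c [*] x n [-] c [*] a) with (c [*] (x n [-] a)) by vec_ring.
    rewrite norm_scal. lra.
  - replace 0 with (Rabs c * 0) by ring. apply CV_mult; [apply Un_cv_const | assumption].
Qed.

Lemma ncv_sub {X : Hilbert} (x y : nat -> X) (a b : X) :
  ncv X x a -> ncv X y b -> ncv X (fun n => x n [-] y n) (a [-] b).
Proof.
  intros Hx Hy. apply (ncv_scal (-1)) in Hy. generalize (ncv_add _ _ _ _ Hx Hy).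
  rewrite !ncv_norm. replace (a [+] -1 [*] b) with (a [-] b) by vec_ring.
  apply Un_cv_ext. intro n. f_equal. vec_ring.
Qed.

Lemma norm_cv {X : Hilbert} (x : nat -> X) (a : X) :
  ncv X x a -> Un_cv (fun n => hnorm (x n)) (hnorm a).
Proof.
  intros H e He. destruct (H e He) as [N HN]. exists N. intros n Hn. specialize (HN n Hn).
  eapply Rle_lt_trans; [| exact HN]. unfold Rdist. apply Rabs_le.
  assert (A := norm_triangle (x n [-] a) a). assert (B := norm_triangle (a [-] x n) (x n)).
  replace (x n [-] a [+] a) with (x n) in A by vec_ring.
  replace (a [-] x n [+] x n) with a in B by vec_ring.
  rewrite (norm_sub_sym a) in B. lra.
Qed.

Lemma inner_wcv_ncv_bounded {X : Hilbert} (z w : nat -> X) (a b : X) (M : R) :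
  wcv X z a -> ncv X w b -> (forall n, hnorm (z n) <= M) ->
  Un_cv (fun n => <<z n, w n>>) <<a, b>>.
Proof.
  intros Hz Hw HM. apply ncv_norm in Hw.
  assert (H : Un_cv (fun n => <<z n, w n [-] b>>) 0).
  { apply Un_cv_0 with (g := fun n => M * hnorm (w n [-] b)).
    - intro n. eapply Rle_trans; [apply cauchy_schwarz |].
      apply Rmult_le_compat_r; [apply norm_nonneg | apply HM].
    - replace 0 with (M * 0) by ring. apply CV_mult; [apply Un_cv_const | assumption]. }
  replace <<a, b>> with (<<a, b>> + 0) by ring.
  apply Un_cv_ext with (un := fun n => <<z n, b>> + <<z n, w n [-] b>>).
  - intro n. inner_ring.
  - apply CV_plus; [apply Hz | exact H].
Qed.

Lemma ncv_wcv {X : Hilbert} (x : nat -> X) (a : X) : ncv X x a -> wcv X x a.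
Proof.
  intros Hx y. apply ncv_norm in Hx.
  assert (H : Un_cv (fun n => <<x n [-] a, y>>) 0).
  { apply Un_cv_0 with (g := fun n => hnorm (x n [-] a) * hnorm y).
    - intro n. apply cauchy_schwarz.
    - replace 0 with (0 * hnorm y) by ring. apply CV_mult; [assumption | apply Un_cv_const]. }
  replace <<a, y>> with (0 + <<a, y>>) by ring.
  apply Un_cv_ext with (un := fun n => <<x n [-] a, y>> + <<a, y>>).
  - intro n. inner_ring.
  - apply CV_plus; [exact H | apply Un_cv_const].
Qed.

Lemma inner_cv {X : Hilbert} (x y : nat -> X) (a b : X) :
  ncv X x a -> ncv X y b -> Un_cv (fun n => <<x n, y n>>) <<a, b>>.
Proof.
  intros Hx Hy. destruct (maj_by_pos _ (exist _ _ (norm_cv _ _ Hx))) as [M [_ HM]].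
  apply inner_wcv_ncv_bounded with (M := M); [apply ncv_wcv | |]; trivial.
  intro n. specialize (HM n). rewrite Rabs_pos_eq in HM by apply norm_nonneg. exact HM.
Qed.

(** * Geometric convergence, sequential choice and near-minimizers *)

Lemma Un_cv_pow_0 (r : R) : 0 <= r < 1 -> Un_cv (fun n => r ^ n) 0.
Proof.
  intros H e He. destruct (pow_lt_1_zero r) with (y := e) as [N HN]; trivial.
  - rewrite Rabs_pos_eq; lra.
  - exists N. intros n Hn. unfold Rdist. rewrite Rminus_0_r. auto.
Qed.

(** The increments from stage [n] on sum to at most [C * r ^ n], since the factor [1 - r] cancels
    the sum of the geometric series. *)
Lemma geometric_cauchy {X : Hilbert} (x : nat -> X) (C r : R) : 0 <= r < 1 -> 0 <= C ->
  (forall n, hnorm (x (S n) [-] x n) <= C * (1 - r) * r ^ n) ->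
  exists l, forall n, hnorm (x n [-] l) <= C * r ^ n.
Proof.
  intros Hr HC Hx.
  assert (Hpow : forall n, 0 <= r ^ n) by (intro; apply pow_le; lra).
  assert (tail : forall n k, hnorm (x (n + k)%nat [-] x n) <= C * r ^ n).
  (* The subtracted term makes the bound telescope, so that the induction on [k] closes. *)
  { assert (sharp : forall n k, hnorm (x (n + k)%nat [-] x n) <= C * r ^ n - C * r ^ (n + k)).
    { intros n k. induction k as [|k IH].
      - rewrite Nat.add_0_r. replace (x n [-] x n) with (hzero : X) by vec_ring.
        rewrite norm_zero. lra.
      - rewrite Nat.add_succ_r. specialize (Hx (n + k)%nat).
        assert (A := norm_sub_triangle (x (S (n + k))) (x (n + k)%nat) (x n)).
        simpl. lra. }
    intros n k. specialize (sharp n k). specialize (Hpow (n + k)%nat). nra. }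
  destruct (hcomplete X x) as [l Hl].
  { intros e He.
    assert (Hlim : Un_cv (fun n => C * r ^ n) 0).
    { replace 0 with (C * 0) by ring.
      apply CV_mult; [apply Un_cv_const | apply Un_cv_pow_0; exact Hr]. }
    destruct (Hlim (e / 2)) as [N HN]; [lra |].
    exists N. intros m n Hm Hn. specialize (HN N (le_n N)).
    unfold Rdist in HN. rewrite Rminus_0_r in HN. apply Rabs_def2 in HN.
    assert (A := tail N (m - N)%nat). assert (B := tail N (n - N)%nat).
    replace (N + (m - N))%nat with m in A by lia. replace (N + (n - N))%nat with n in B by lia.
    assert (D := norm_sub_triangle (x m) (x N) (x n)). rewrite (norm_sub_sym (x N)) in D.
    change (hnorm (x m [-] x n) < e). lra. }
  change (ncv X x l) in Hl.
  exists l. intro n. apply Rnot_lt_le. intro Hlt.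
  destruct (Hl (hnorm (x n [-] l) - C * r ^ n)) as [N HN]; [lra |].
  specialize (HN (n + N)%nat (Nat.le_add_l N n)).
  assert (A := tail n N). assert (B := norm_sub_triangle (x n) (x (n + N)%nat) l).
  rewrite (norm_sub_sym (x n) (x (n + N)%nat)) in B. lra.
Qed.

Lemma dependent_choice (A : Type) (P : nat -> A -> Prop) (Q : nat -> A -> A -> Prop) (a0 : A) :
  P 0%nat a0 -> (forall n a, P n a -> exists b, P (S n) b /\ Q n a b) ->
  exists f : nat -> A, f 0%nat = a0 /\ (forall n, P n (f n)) /\ (forall n, Q n (f n) (f (S n))).
Proof.
  intros H0 Hstep.
  set (next n (s : {a | P n a}) := constructive_indefinite_description _ (Hstep n _ (proj2_sig s))).
  set (F := nat_rect (fun n => {a | P n a}) (exist _ a0 H0)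
    (fun n s => exist _ (proj1_sig (next n s)) (proj1 (proj2_sig (next n s))))).
  exists (fun n => proj1_sig (F n)). split; [reflexivity | split; intro n].
  - exact (proj2_sig (F n)).
  - exact (proj2 (proj2_sig (next n (F n)))).
Qed.

(** Completeness of the reals, applied to the values of [- F], yields a point within [e] of the
    infimum; if its value exceeds [F a0], then [a0] itself is within [e]. *)
Lemma near_minimizer (A : Type) (P : A -> Prop) (F : A -> R) (m : R) (a0 : A) (e : R) :
  P a0 -> (forall a, P a -> m <= F a) -> 0 < e ->
  exists a, P a /\ F a <= F a0 /\ forall b, P b -> F a <= F b + e.
Proof.
  intros H0 Hm He.
  destruct (completeness (fun x => exists a, P a /\ x = - F a)) as [s [Hub Hlub]].
  - exists (- m). intros x [a [Ha ->]]. specialize (Hm a Ha). lra.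
  - exists (- F a0), a0. auto.
  - assert (Hs : forall b, P b -> - s <= F b).
    { intros b Hb. assert (- F b <= s) by (apply Hub; exists b; auto). lra. }
    destruct (classic (exists a, P a /\ F a < - s + e)) as [[a [Ha Hlt]] | None].
    + destruct (Rle_dec (F a) (F a0)) as [L | L].
      * exists a. repeat split; trivial. intros b Hb. specialize (Hs b Hb). lra.
      * exists a0. repeat split; [trivial | lra |]. intros b Hb. specialize (Hs b Hb). lra.
    + exfalso. assert (s <= s - e); [| lra]. apply Hlub. intros x [a [Ha ->]].
      destruct (Rlt_dec (F a) (- s + e)) as [L | L]; [exfalso; apply None; exists a; auto | lra].
Qed.

(** * Mixed and regular coderivatives *)

(* Sokal's gliding hump: one of the two points [x + c z], [x - c z] gives
   [|<z, .>| >= c |z|^2]. *)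
Lemma wcv_bounded {X : Hilbert} (z : nat -> X) (a : X) :
  wcv X z a -> exists M, forall k, hnorm (z k) <= M.
Proof.
  intro Hz. apply NNPP. intro Hunb.
  assert (big : forall M, exists k, M < hnorm (z k)).
  { intro M. apply NNPP. intro N. apply Hunb. exists M. intro k.
    apply Rnot_lt_le. intro. apply N. exists k. assumption. }
  assert (Hpow : forall n, 0 < (/4) ^ n) by (intro; apply pow_lt; lra).
  destruct (dependent_choice X (fun _ _ => True)
    (fun n x y => hnorm (y [-] x) <= (/4) ^ n /\
       exists k, INR n <= (/4) ^ n * hnorm (z k) /\
                 (/4) ^ n * hnorm (z k) <= Rabs <<z k, y>>) hzero)
    as [x [_ [_ Hx]]]; trivial.
  { intros n x _. specialize (Hpow n). set (r := (/4) ^ n) in *.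
    assert (Hn := pos_INR n).
    destruct (big (INR n / r)) as [k Hk].
    assert (Hzk : 0 < hnorm (z k)).
    { eapply Rle_lt_trans; [| exact Hk].
      apply Rmult_le_pos; [lra | left; apply Rinv_0_lt_compat; lra]. }
    (* With this scale the step has length [r = (/4) ^ n] and contributes [r * hnorm (z k)] to the
       pairing with [z k]; the sign [s] below prevents cancellation with [<<z k, x>>]. *)
    set (c := r / hnorm (z k)).
    assert (Hc : 0 < c) by (apply Rdiv_lt_0_compat; assumption).
    assert (Hcz : c * hnorm (z k) = r) by (unfold c; field; lra).
    assert (Hczz : c * <<z k, z k>> = r * hnorm (z k))
      by (rewrite <- norm_sqr, <- Rmult_assoc, Hcz; ring).
    assert (step : exists s, Rabs s = 1 /\ 0 <= s * <<z k, x>>).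
    { destruct (Rle_dec 0 <<z k, x>>).
      - exists 1. rewrite Rabs_R1. lra.
      - exists (-1). rewrite Rabs_left; lra. }
    destruct step as [s [Hs Hsx]].
    assert (Hss : s * s = 1) by (unfold Rabs in Hs; destruct (Rcase_abs s); nra).
    exists (x [+] (s * c) [*] z k). repeat split.
    - replace (x [+] (s * c) [*] z k [-] x) with ((s * c) [*] z k) by vec_ring.
      rewrite norm_scal, Rabs_mult, Hs, (Rabs_pos_eq c) by lra. lra.
    - exists k. split.
      + apply Rmult_lt_compat_r with (r := r) in Hk; [| lra].
        unfold Rdiv in Hk. rewrite Rmult_assoc, Rinv_l in Hk; lra.
      + rewrite <- (Rmult_1_l (Rabs _)), <- Hs, <- Rabs_mult.
        eapply Rle_trans; [| apply Rle_abs].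
        expand_inner.
        replace (s * (<<z k, x>> + s * c * <<z k, z k>>))
          with (s * <<z k, x>> + s * s * (c * <<z k, z k>>)) by ring.
        rewrite Hss, Hczz. lra. }
  destruct (geometric_cauchy x (4/3) (/4)) as [l Hl]; [lra | lra | |].
  { intro n. destruct (Hx n) as [H _]. lra. }
  destruct (maj_by_pos _ (exist _ _ (Hz l))) as [M [_ HM]].
  (* The limit lies within a third of [(/4) ^ n] of [x (S n)], so [|<z_k, l>|] keeps two thirds of
     [(/4) ^ n * hnorm (z k)] and is at least [2 n / 3]; this contradicts the bound [M] once
     [n > 3 M]. *)
  destruct (INR_unbounded (3 * M)) as [n Hn].
  destruct (Hx n) as [_ [k [Hk1 Hk2]]]. specialize (HM k). specialize (Hl (S n)). simpl in Hl.
  assert (A := cauchy_schwarz (z k) (x (S n) [-] l)). rewrite inner_sub_r in A.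
  assert (B := Rabs_triang_inv <<z k, x (S n)>> <<z k, l>>).
  assert (hnorm (z k) * hnorm (x (S n) [-] l) <= hnorm (z k) * (4 / 3 * (/ 4 * (/ 4) ^ n)))
    by (apply Rmult_le_compat_l; [apply norm_nonneg | exact Hl]).
  assert (0 <= INR n) by apply pos_INR. nra.
Qed.

Definition regular_coderiv_psd (X : Hilbert) (T : setmap X) : Prop :=
  forall u v w z, T u v -> reg_coderiv X T u v w z -> 0 <= <<z, w>>.

Lemma coderiv_psd_regular {X : Hilbert} (T : setmap X) :
  coderiv_psd X T <-> regular_coderiv_psd X T.
Proof.
  split.
  - intros H u v w z HT Hz. apply (H u v HT).
    exists (fun _ => u), (fun _ => v), (fun _ => w), (fun _ => z).
    repeat split; trivial; try apply ncv_const. apply ncv_wcv, ncv_const.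
  - intros H u v _ w z [uk [vk [wk [zk [HT [_ [_ [Hw [Hz Hk]]]]]]]]].
    destruct (wcv_bounded _ _ Hz) as [M HM].
    apply Rle_cv_lim with (Un := fun _ => 0) (Vn := fun k => <<zk k, wk k>>).
    + intro k. exact (H _ _ _ _ (HT k) (Hk k)).
    + apply Un_cv_const.
    + apply inner_wcv_ncv_bounded with (M := M); assumption.
Qed.

(** Divided by the length [D] of the increment, the quadratic error is at most [Rabs C * D], which
    tends to [0]. Closeness is asked of [u'] only, to match semilocal hypomonotonicity, which is
    local in the first variable. *)
Lemma reg_coderiv_of_quadratic {X : Hilbert} (T : setmap X) (u v w z : X) (C d : R) : 0 < d ->
  (forall u' v', T u' v' -> hnorm (u' [-] u) < d ->
     <<z, u' [-] u>> - <<w, v' [-] v>> <=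
       C * (<<u' [-] u, u' [-] u>> + <<v' [-] v, v' [-] v>>)) ->
  reg_coderiv X T u v w z.
Proof.
  intros Hd H e He. assert (HC := Rabs_pos C).
  exists (Rmin d (e / (Rabs C + 1))). split.
  { apply Rmin_glb_lt; [lra | apply Rdiv_lt_0_compat; lra]. }
  intros [u' v'] HT [Hpos Hlt]. unfold gph in HT. simpl in HT.
  set (D := pnorm X _) in *.
  assert (HD : D * D = <<u' [-] u, u' [-] u>> + <<v' [-] v, v' [-] v>>).
  { unfold D, pnorm, pinner. simpl. apply sqrt_sqrt.
    generalize (hinner_pos X (u' [-] u)) (hinner_pos X (v' [-] v)). lra. }
  assert (D < d) by (eapply Rlt_le_trans; [exact Hlt | apply Rmin_l]).
  assert (HDe : D <= e / (Rabs C + 1))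
    by (left; eapply Rlt_le_trans; [exact Hlt | apply Rmin_r]).
  apply Rmult_le_compat_r with (r := Rabs C + 1) in HDe; [| lra].
  unfold Rdiv in HDe. rewrite Rmult_assoc, Rinv_l, Rmult_1_r in HDe by lra.
  assert (Hu : hnorm (u' [-] u) < d).
  { apply Rle_lt_trans with D; [| assumption]. apply norm_le; [lra |].
    rewrite HD. generalize (hinner_pos X (v' [-] v)). lra. }
  specialize (H u' v' HT Hu). rewrite <- HD in H.
  apply Rmult_le_reg_r with D; [exact Hpos |].
  unfold Rdiv. rewrite Rmult_assoc, Rinv_l, Rmult_1_r by lra.
  unfold pinner. simpl. rewrite inner_opp_l.
  assert (C * (D * D) <= Rabs C * (D * D))
    by (apply Rmult_le_compat_r; [nra | apply Rle_abs]).
  nra.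
Qed.

(** * Minty's theorem *)

(** Adjoining [(x, y)] to the graph keeps it monotone, so by maximality the point is already
    there. *)
Lemma maximal_monotone_mem {X : Hilbert} (T : setmap X) (x y : X) : maximal_monotone X T ->
  (forall a b, T a b -> 0 <= <<y [-] b, x [-] a>>) -> T x y.
Proof.
  intros [Hmon Hmax] H.
  apply (Hmax (fun u v => T u v \/ (u = x /\ v = y))); [| now left | now right].
  intros u1 v1 u2 v2 [H1 | [-> ->]] [H2 | [-> ->]].
  - now apply Hmon.
  - replace <<v1 [-] y, u1 [-] x>> with <<y [-] v1, x [-] u1>> by inner_ring. now apply H.
  - now apply H.
  - replace (x [-] x) with (hzero : X) by vec_ring. rewrite inner_zero_r. lra.
Qed.

(* The triples satisfying this form the epigraph of the Fitzpatrick function of [T]. *)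
Definition fitzpatrick_epi {X : Hilbert} (T : setmap X) (p : X * X * R) : Prop :=
  forall a b, T a b -> <<fst (fst p), b>> + <<a, snd (fst p)>> - <<a, b>> <= snd p.

(** If [t] were below [<<x, y>>], the point [(x, y)] would be monotonically related to the whole
    graph, hence in it, and the epigraph condition tested at [(x, y)] itself would give
    [<<x, y>> <= t]. *)
Lemma fitzpatrick_ge_inner {X : Hilbert} (T : setmap X) (x y : X) (t : R) :
  maximal_monotone X T -> fitzpatrick_epi T (x, y, t) -> <<x, y>> <= t.
Proof.
  intros HT H. apply Rnot_lt_le. intro Hlt. unfold fitzpatrick_epi in H. simpl in H.
  assert (Hxy : T x y).
  { apply maximal_monotone_mem; trivial. intros a b Hab. specialize (H a b Hab).
    replace <<y [-] b, x [-] a>> with (<<x, y>> - (<<x, b>> + <<a, y>> - <<a, b>>)) by inner_ring.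
    lra. }
  specialize (H x y Hxy). lra.
Qed.

Lemma fitzpatrick_epi_convex {X : Hilbert} (T : setmap X) (x1 y1 x2 y2 : X) (t1 t2 l : R) :
  0 <= l <= 1 -> fitzpatrick_epi T (x1, y1, t1) -> fitzpatrick_epi T (x2, y2, t2) ->
  fitzpatrick_epi T ((1 - l) [*] x1 [+] l [*] x2, (1 - l) [*] y1 [+] l [*] y2,
                     (1 - l) * t1 + l * t2).
Proof.
  intros Hl H1 H2 a b Hab. specialize (H1 a b Hab). specialize (H2 a b Hab). simpl in *.
  expand_inner. nra.
Qed.

(* The minimizer of the strongly convex function "Fitzpatrick function of [T] plus half the
   squared norm" is, up to sign and swap, the required point of the graph. *)
Lemma minty_zero {X : Hilbert} (T : setmap X) :
  proper X T -> maximal_monotone X T -> exists u, T u (hopp u).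
Proof.
  intros [a0 [b0 H0]] HT.
  set (J := fun p : X * X * R => snd p + / 2 * (<<fst (fst p), fst (fst p)>> +
                                             <<snd (fst p), snd (fst p)>>)).
  (* On the epigraph, [J] is at least [<x, y> + (|x|^2 + |y|^2) / 2 = |x + y|^2 / 2]. *)
  assert (HJ : forall p, fitzpatrick_epi T p -> 0 <= J p).
  { intros [[x y] t] Hp. apply fitzpatrick_ge_inner in Hp; trivial. unfold J. simpl.
    assert (P := hinner_pos X (x [+] y)).
    replace <<x [+] y, x [+] y>> with (<<x, x>> + 2 * <<x, y>> + <<y, y>>) in P by inner_ring.
    lra. }
  assert (Hgraph : forall a b, T a b -> fitzpatrick_epi T (a, b, <<a, b>>)).
  { intros a b Hab c d Hcd. simpl.
    assert (M := proj1 HT a b c d Hab Hcd).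
    replace <<b [-] d, a [-] c>> with (<<a, b>> - (<<a, d>> + <<c, b>> - <<c, d>>)) in M
      by inner_ring. lra. }
  assert (Hpow : forall n, 0 < (/2) ^ n) by (intro; apply pow_lt; lra).
  assert (Hmin : forall n, exists p, fitzpatrick_epi T p /\
            forall q, fitzpatrick_epi T q -> J p <= J q + (/2) ^ n * (/2) ^ n).
  { intro n. destruct (near_minimizer _ (fitzpatrick_epi T) J 0 (a0, b0, <<a0, b0>>)
      ((/2) ^ n * (/2) ^ n)) as [p [Hp [_ Hq]]]; auto.
    - apply Rmult_lt_0_compat; apply Hpow.
    - exists p. auto. }
  destruct (functional_choice _ Hmin) as [p Hp].
  set (x := fun n => fst (fst (p n))). set (y := fun n => snd (fst (p n))).
  set (t := fun n => snd (p n)).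
  assert (Epi : forall n, fitzpatrick_epi T (x n, y n, t n)).
  { intro n. unfold x, y, t. rewrite <- !surjective_pairing. apply Hp. }
  assert (Near : forall n x' y' t', fitzpatrick_epi T (x', y', t') ->
    t n + / 2 * (<<x n, x n>> + <<y n, y n>>) <=
    t' + / 2 * (<<x', x'>> + <<y', y'>>) + (/2) ^ n * (/2) ^ n).
  { intros n x' y' t' H. exact (proj2 (Hp n) _ H). }
  (* Both near-minimizers are compared with their midpoint, where the quadratic part of [J] lies
     below its average by an eighth of the squared distance. *)
  assert (Close : forall n, <<x (S n) [-] x n, x (S n) [-] x n>> +
    <<y (S n) [-] y n, y (S n) [-] y n>> <= 8 * ((/2) ^ n * (/2) ^ n)).
  { intro n.
    assert (Mid := fitzpatrick_epi_convex T _ _ _ _ _ _ (/2) ltac:(lra) (Epi n) (Epi (S n))).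
    assert (N1 := Near n _ _ _ Mid). assert (N2 := Near (S n) _ _ _ Mid). simpl in N2.
    specialize (Hpow n). revert N1 N2. repeat progress expand_inner.
    rewrite (hinner_sym X (x (S n)) (x n)), (hinner_sym X (y (S n)) (y n)). nra. }
  destruct (geometric_cauchy x 6 (/2)) as [xb Hx]; [lra | lra | |].
  { intro n. specialize (Close n). specialize (Hpow n).
    assert (P := hinner_pos X (y (S n) [-] y n)). apply norm_le; nra. }
  destruct (geometric_cauchy y 6 (/2)) as [yb Hy]; [lra | lra | |].
  { intro n. specialize (Close n). specialize (Hpow n).
    assert (P := hinner_pos X (x (S n) [-] x n)). apply norm_le; nra. }
  assert (Hhalf : Un_cv (fun n => (/2) ^ n) 0) by (apply Un_cv_pow_0; lra).
  assert (Cx : ncv X x xb) by (eapply ncv_of_bound; [exact Hx | now apply Un_cv_scal_0]).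
  assert (Cy : ncv X y yb) by (eapply ncv_of_bound; [exact Hy | now apply Un_cv_scal_0]).
  (* First-order optimality: the [n]-th near-minimizer is moved towards [(a, b)] by the fraction
     [(/2) ^ n]. Dividing by this fraction leaves a tolerance [(/2) ^ n], which vanishes in the
     limit. *)
  assert (Opt : forall a b, T a b -> <<xb [+] yb, xb [+] yb>> <= <<a [+] yb, b [+] xb>>).
  { intros a b Hab.
    (* The factor [0] is the limit of [(/2) ^ n], kept so that the limit has the shape of the
       sequence. *)
    assert (L : <<xb, yb>> - <<a, b>> <=
      <<xb, a [-] xb>> + <<yb, b [-] yb>> +
      0 * (/ 2 * (<<a [-] xb, a [-] xb>> + <<b [-] yb, b [-] yb>>) + 1)).
    { apply Rle_cv_lim with (Un := fun n => <<x n, y n>> - <<a, b>>)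
        (Vn := fun n => <<x n, a [-] x n>> + <<y n, b [-] y n>> +
          (/2) ^ n * (/ 2 * (<<a [-] x n, a [-] x n>> + <<b [-] y n, b [-] y n>>) + 1)).
      - intro n. assert (Ge := fitzpatrick_ge_inner T _ _ _ HT (Epi n)).
        specialize (Hpow n).
        assert (Hle : (/2) ^ n <= 1) by (rewrite <- (pow1 n); apply pow_incr; lra).
        assert (N := Near n _ _ _ (fitzpatrick_epi_convex T _ _ _ _ _ _ ((/2) ^ n) ltac:(lra)
                       (Epi n) (Hgraph a b Hab))).
        set (r := (/2) ^ n) in *.
        apply Rmult_le_reg_l with r; [exact Hpow |].
        apply Rle_trans with (r * (t n - <<a, b>>)); [apply Rmult_le_compat_l; lra |].
        revert N. repeat progress expand_inner.
        rewrite (hinner_sym X (x n) a), (hinner_sym X (y n) b). nra.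
      - apply CV_minus; [now apply inner_cv | apply Un_cv_const].
      - assert (Ca : ncv X (fun n => a [-] x n) (a [-] xb))
          by (apply ncv_sub; [apply ncv_const | trivial]).
        assert (Cb : ncv X (fun n => b [-] y n) (b [-] yb))
          by (apply ncv_sub; [apply ncv_const | trivial]).
        apply CV_plus; [apply CV_plus; now apply inner_cv |].
        apply CV_mult; [exact Hhalf |].
        apply CV_plus; [| apply Un_cv_const].
        apply CV_mult; [apply Un_cv_const |].
        apply CV_plus; now apply inner_cv. }
    revert L. repeat progress expand_inner.
    rewrite (hinner_sym X yb xb), (hinner_sym X xb a), (hinner_sym X yb b). lra. }
  assert (Hmem : T (hopp yb) (hopp xb)).
  { apply maximal_monotone_mem; trivial. intros a b Hab.
    replace <<hopp xb [-] b, hopp yb [-] a>> with <<a [+] yb, b [+] xb>> by inner_ring.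
    eapply Rle_trans; [apply hinner_pos | now apply Opt]. }
  exists (hopp yb). replace (hopp (hopp yb)) with (hopp xb); [exact Hmem |].
  (* Optimality tested at the graph point just found gives [|xb + yb|^2 <= 0]. *)
  apply sub_eq_zero. assert (A := Opt _ _ Hmem). assert (B := hinner_pos X (xb [+] yb)).
  replace <<hopp yb [+] yb, hopp xb [+] xb>> with 0 in A by inner_ring.
  replace <<hopp xb [-] hopp (hopp yb), hopp xb [-] hopp (hopp yb)>>
    with <<xb [+] yb, xb [+] yb>> by inner_ring. lra.
Qed.

Lemma minty {X : Hilbert} (T : setmap X) (x : X) :
  proper X T -> maximal_monotone X T -> exists u, T u (x [-] u).
Proof.
  intros [a0 [b0 H0]] [Hmon Hmax].
  destruct (minty_zero (fun u v => T u (v [+] x))) as [u Hu].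
  - exists a0, (b0 [-] x). replace (b0 [-] x [+] x) with b0 by vec_ring. exact H0.
  - split.
    + intros u1 v1 u2 v2 H1 H2. generalize (Hmon _ _ _ _ H1 H2).
      replace (v1 [+] x [-] (v2 [+] x)) with (v1 [-] v2) by vec_ring. trivial.
    + intros S HS Hsub u v HSuv.
      apply (Hmax (fun u v => S u (v [-] x))).
      * intros u1 v1 u2 v2 H1 H2. generalize (HS _ _ _ _ H1 H2).
        replace (v1 [-] x [-] (v2 [-] x)) with (v1 [-] v2) by vec_ring. trivial.
      * intros u' v' HT. apply Hsub. replace (v' [-] x [+] x) with v' by vec_ring. exact HT.
      * replace (v [+] x [-] x) with v by vec_ring. exact HSuv.
  - exists u. replace (x [-] u) with (hopp u [+] x) by vec_ring. exact Hu.
Qed.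

(* Moving along the graph so that [u + v] varies in the direction [z - w] violates the
   normal inequality when [|z + w| < |z - w|], i.e. when [<z, w> < 0]. *)
Lemma maximal_monotone_psd {X : Hilbert} (T : setmap X) :
  proper X T -> maximal_monotone X T -> regular_coderiv_psd X T.
Proof.
  intros Hprop HT u v w z Huv Hz. apply Rnot_lt_le. intro Hneg.
  set (h := z [-] w).
  assert (Hh : <<h, h>> = <<z, z>> - 2 * <<z, w>> + <<w, w>>) by (unfold h; inner_ring).
  assert (Hs : <<z [+] w, z [+] w>> = <<z, z>> + 2 * <<z, w>> + <<w, w>>) by inner_ring.
  assert (gap : hnorm (z [+] w) < hnorm h).
  { apply Rsqr_incrst_0; try apply norm_nonneg. unfold Rsqr. rewrite !norm_sqr. lra. }
  assert (Hzw := norm_nonneg (z [+] w)).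
  destruct (Hz ((hnorm h - hnorm (z [+] w)) / 4)) as [d [Hd Hdelta]]; [lra |].
  (* [t h] has length [d / 2], which will keep the new graph point where the normal inequality
     holds. *)
  set (t := d / (2 * hnorm h)).
  assert (Ht : 0 < t) by (apply Rdiv_lt_0_compat; lra).
  assert (Hth : t * hnorm h = d / 2) by (unfold t; field; lra).
  destruct (minty T (u [+] v [+] t [*] h) Hprop HT) as [u' Hu'].
  set (v' := u [+] v [+] t [*] h [-] u') in *.
  set (du := u' [-] u). set (dv := v' [-] v).
  assert (Hsum : du [+] dv = t [*] h) by (unfold du, dv, v'; vec_ring).
  assert (Mon : 0 <= <<dv, du>>) by (now apply (proj1 HT)).
  assert (Hsum2 : <<du, du>> + <<dv, dv>> + 2 * <<dv, du>> = (t * hnorm h) * (t * hnorm h)).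
  { replace (t * hnorm h * (t * hnorm h)) with (t * t * (hnorm h * hnorm h)) by ring.
    rewrite norm_sqr. replace (t * t * <<h, h>>) with <<t [*] h, t [*] h>> by inner_ring.
    rewrite <- Hsum. inner_ring. }
  assert (Hdiff : hnorm (du [-] dv) <= t * hnorm h).
  { apply norm_le; [nra |]. rewrite <- Hsum2.
    replace <<du [-] dv, du [-] dv>> with (<<du, du>> + <<dv, dv>> - 2 * <<dv, du>>) by inner_ring.
    lra. }
  specialize (Hdelta (u', v') Hu'). unfold psub in Hdelta. simpl in Hdelta.
  fold du dv in Hdelta. set (D := pnorm X (du, dv)) in *.
  assert (HD : D * D = <<du, du>> + <<dv, dv>>).
  { unfold D, pnorm, pinner. simpl. apply sqrt_sqrt.
    generalize (hinner_pos X du) (hinner_pos X dv). lra. }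
  assert (HD0 : 0 <= D) by apply sqrt_pos.
  assert (HDle : D <= t * hnorm h) by (apply Rsqr_incr_0_var; [unfold Rsqr; lra | nra]).
  (* [<z, du> - <w, dv>] is half of [<z - w, du + dv> + <z + w, du - dv>]; the first term equals
     [t |h|^2] and the second is at least [- t |h| |z + w|]. *)
  assert (Hval : t * hnorm h * (hnorm h - hnorm (z [+] w)) / 2 <= pinner X (z, hopp w) (du, dv)).
  { unfold pinner. simpl. rewrite inner_opp_l.
    replace (<<z, du>> + - <<w, dv>>)
      with (/ 2 * (<<h, du [+] dv>> + <<z [+] w, du [-] dv>>))
      by (unfold h; repeat progress expand_inner; field).
    rewrite Hsum, inner_scal_r, <- norm_sqr.
    assert (G := inner_ge (z [+] w) (du [-] dv)).
    assert (hnorm (z [+] w) * hnorm (du [-] dv) <= hnorm (z [+] w) * (t * hnorm h))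
      by (apply Rmult_le_compat_l; assumption).
    lra. }
  assert (Hpos : 0 < D).
  { destruct HD0 as [| HD0]; trivial. exfalso. rewrite <- HD0 in HD.
    assert (A := hinner_pos X du). assert (B := hinner_pos X dv).
    assert (C := hinner_pos X (du [-] dv)).
    replace <<du [-] dv, du [-] dv>> with (<<du, du>> + <<dv, dv>> - 2 * <<dv, du>>) in C
      by inner_ring.
    assert (0 < t * hnorm h) by lra. nra. }
  assert (Hlim := Hdelta ltac:(lra)).
  apply Rmult_le_compat_r with (r := D) in Hlim; [| lra].
  unfold Rdiv in Hlim at 1. rewrite Rmult_assoc, Rinv_l, Rmult_1_r in Hlim by lra.
  assert ((hnorm h - hnorm (z [+] w)) / 4 * D <= (hnorm h - hnorm (z [+] w)) / 4 * (t * hnorm h))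
    by (apply Rmult_le_compat_l; lra).
  assert (0 < t * hnorm h * (hnorm h - hnorm (z [+] w)))
    by (apply Rmult_lt_0_compat; lra).
  lra.
Qed.

(** * A smooth variational principle *)

(* Borwein-Preiss: the perturbation is the sum of the functions [2^-n |y - y_n|^2], recorded
   at stage [n] through its quadratic coefficient [2 - 2 * 2^-n] and its gradient [2 q_n] at
   the current point. *)
Lemma variational_principle {X : Hilbert} (A : Type) (P : A -> Prop) (Y : A -> X) (F : A -> R)
    (m e : R) :
  (exists a, P a) -> (forall a, P a -> m <= F a) ->
  (forall (a : nat -> A) l, (forall n, P (a n)) -> ncv X (fun n => Y (a n)) l ->
     exists b, P b /\ Y b = l /\ Un_cv (fun n => F (a n)) (F b)) ->
  0 < e ->
  exists a q, P a /\ hnorm q <= e /\ (forall b, P b -> F a <= F b + e) /\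
    forall b, P b -> F a + <<q, Y b [-] Y a>> <= F b + 2 * <<Y b [-] Y a, Y b [-] Y a>>.
Proof.
  intros [a1 H1] Hm Hcl He.
  (* [25 = 16 + 8 + 1]: the gradient term, the quadratic term and the initial tolerance cost at most
     [25 * s * s] in the near-minimality of the final point. *)
  set (s := Rmin 1 (e / 25)).
  assert (Hs : 0 < s /\ s <= 1 /\ 25 * s <= e).
  { unfold s. assert (A1 := Rmin_l 1 (e / 25)). assert (A2 := Rmin_r 1 (e / 25)).
    repeat split; [apply Rmin_glb_lt; lra | lra | lra]. }
  destruct Hs as [Hs [Hs1 Hse]].
  set (h := fun n => (/2) ^ n).
  assert (Hh : forall n, 0 < h n <= 1).
  { intro n. split; [apply pow_lt; lra |]. unfold h. rewrite <- (pow1 n). apply pow_incr. lra. }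
  (* The tolerance is cubic in [h n]: stage [n] raises the quadratic coefficient by [h n], so the
     squared step is at most [s * s * h n * h n]. *)
  set (I := fun n (p : A * X) => P (fst p) /\ forall b, P b ->
    F (fst p) <= F b + (2 - 2 * h n) * <<Y b [-] Y (fst p), Y b [-] Y (fst p)>>
      + 2 * <<snd p, Y b [-] Y (fst p)>> + s * s * (h n * h n * h n)).
  destruct (near_minimizer A P F m a1 (s * s)) as [a0 [H0 [_ Hmin0]]]; trivial.
  { nra. }
  destruct (dependent_choice (A * X) I
    (fun n p p' => hnorm (Y (fst p') [-] Y (fst p)) <= s * h n /\
                   hnorm (snd p' [-] snd p) <= 2 * s * h n) (a0, hzero))
    as [p [Hp0 [HI HQ]]].
  { split; [exact H0 |]. intros b Hb. simpl. rewrite inner_zero_l.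
    generalize (Hmin0 b Hb). unfold h. simpl. lra. }
  { intros n [a q] [Ha Hq]. simpl in Ha, Hq. destruct (Hh n) as [Hn Hn1].
    assert (Hsn : h (S n) = h n / 2) by (unfold h; simpl; field).
    set (k := 2 - 2 * h (S n)).
    set (H := fun b => F b + k * <<Y b [-] Y a, Y b [-] Y a>> + 2 * <<q, Y b [-] Y a>>).
    destruct (near_minimizer A P H (F a - s * s * (h n * h n * h n)) a
      (s * s * (h (S n) * h (S n) * h (S n)))) as [b [Hb [Hba Hmin]]]; trivial.
    - intros b Hb. specialize (Hq b Hb). unfold H, k. rewrite Hsn.
      assert (0 <= h n * <<Y b [-] Y a, Y b [-] Y a>>)
        by (apply Rmult_le_pos; [lra | apply hinner_pos]).
      lra.
    - rewrite Hsn. repeat apply Rmult_lt_0_compat; lra.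
    - assert (Hstep : hnorm (Y b [-] Y a) <= s * h n).
      { apply norm_le; [apply Rmult_le_pos; lra |].
        unfold H in Hba. specialize (Hq b Hb).
        replace (Y a [-] Y a) with (hzero : X) in Hba by vec_ring.
        rewrite !inner_zero_r in Hba. unfold k in Hba. rewrite Hsn in Hba.
        apply Rmult_le_reg_l with (h n); [lra |]. lra. }
      (* Recentring the quadratic from [Y a] to [Y b] moves its linear part into the gradient. *)
      exists (b, q [+] k [*] (Y b [-] Y a)). split; [split; [exact Hb |] | split].
      + intros c Hc. simpl. specialize (Hmin c Hc). unfold H in Hmin. fold k.
        revert Hmin. set (ya := Y a). set (yb := Y b). set (yc := Y c).
        repeat progress expand_inner.
        rewrite (hinner_sym X ya yb), (hinner_sym X yc ya), (hinner_sym X yc yb). lra.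
      + exact Hstep.
      + simpl. replace (q [+] k [*] (Y b [-] Y a) [-] q) with (k [*] (Y b [-] Y a)) by vec_ring.
        assert (Hk : 0 <= k <= 2) by (unfold k; specialize (Hh (S n)); lra).
        rewrite norm_scal, Rabs_pos_eq by lra.
        assert (B := norm_nonneg (Y b [-] Y a)). nra. }
  destruct (geometric_cauchy (fun n => Y (fst (p n))) (2 * s) (/2)) as [l Hl]; [lra | lra | |].
  { intro n. destruct (HQ n) as [Q _]. fold (h n). lra. }
  destruct (geometric_cauchy (fun n => snd (p n)) (4 * s) (/2)) as [q Hq]; [lra | lra | |].
  { intro n. destruct (HQ n) as [_ Q]. fold (h n). lra. }
  assert (Hhalf : Un_cv h 0) by (apply Un_cv_pow_0; lra).
  assert (Cl : ncv X (fun n => Y (fst (p n))) l)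
    by (eapply ncv_of_bound; [exact Hl | now apply Un_cv_scal_0]).
  assert (Cq : ncv X (fun n => snd (p n)) q)
    by (eapply ncv_of_bound; [exact Hq | now apply Un_cv_scal_0]).
  destruct (Hcl (fun n => fst (p n)) l) as [a [Ha [HY HF]]]; [intro n; apply HI | exact Cl |].
  assert (Hqs : hnorm q <= 4 * s).
  { specialize (Hq 0%nat). rewrite Hp0 in Hq. simpl in Hq.
    rewrite norm_sub_sym in Hq. replace (q [-] hzero) with q in Hq by vec_ring. lra. }
  assert (Hls : hnorm (Y a0 [-] Y a) <= 2 * s).
  { specialize (Hl 0%nat). rewrite Hp0 in Hl. simpl in Hl. rewrite HY. lra. }
  assert (Opt : forall b, P b ->
    F a <= F b + 2 * <<Y b [-] Y a, Y b [-] Y a>> + 2 * <<q, Y b [-] Y a>>).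
  { intros b Hb. rewrite HY.
    assert (L : F a <= F b + 2 * <<Y b [-] l, Y b [-] l>> + 2 * <<q, Y b [-] l>> + s * s * 0).
    { assert (Cb : ncv X (fun n => Y b [-] Y (fst (p n))) (Y b [-] l))
        by (apply ncv_sub; [apply ncv_const | exact Cl]).
      apply Rle_cv_lim with (Un := fun n => F (fst (p n)))
        (Vn := fun n => F b + 2 * <<Y b [-] Y (fst (p n)), Y b [-] Y (fst (p n))>> +
                        2 * <<snd (p n), Y b [-] Y (fst (p n))>> + s * s * h n).
      - intro n. destruct (HI n) as [_ Hn]. specialize (Hn b Hb).
        destruct (Hh n) as [h0 h1].
        assert (B := hinner_pos X (Y b [-] Y (fst (p n)))).
        assert (0 <= h n * <<Y b [-] Y (fst (p n)), Y b [-] Y (fst (p n))>>)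
          by (apply Rmult_le_pos; lra).
        assert (h n * h n * h n <= h n) by nra.
        assert (s * s * (h n * h n * h n) <= s * s * h n)
          by (apply Rmult_le_compat_l; nra).
        lra.
      - exact HF.
      - apply CV_plus; [| now apply CV_mult; [apply Un_cv_const |]].
        apply CV_plus; [apply CV_plus; [apply Un_cv_const |] |];
          (apply CV_mult; [apply Un_cv_const | now apply inner_cv]). }
    lra. }
  exists a, ((-2) [*] q). split; [exact Ha | split; [| split]].
  - rewrite norm_scal, Rabs_left by lra. lra.
  - intros b Hb. specialize (Opt a0 H0). specialize (Hmin0 b Hb).
    assert (G := inner_le q (Y a0 [-] Y a)). rewrite <- norm_sqr in Opt.
    assert (0 <= hnorm (Y a0 [-] Y a)) by apply norm_nonneg.
    assert (0 <= hnorm q) by apply norm_nonneg.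
    assert (hnorm q * hnorm (Y a0 [-] Y a) <= 4 * s * (2 * s))
      by (apply Rmult_le_compat; assumption).
    assert (hnorm (Y a0 [-] Y a) * hnorm (Y a0 [-] Y a) <= 2 * s * (2 * s))
      by (apply Rmult_le_compat; assumption).
    assert (s * s <= s) by nra. lra.
  - intros b Hb. specialize (Opt b Hb). expand_inner. revert Opt. expand_inner. lra.
Qed.

(* [Y] Lipschitz-invertible on the graph makes its image closed. *)
Lemma graph_complete {X : Hilbert} (T : setmap X) (s c : R) (u v : nat -> X) (l : X) :
  closed_graph X T -> 0 < c -> (forall n, T (u n) (v n)) ->
  (forall n k, c * hnorm (u n [-] u k) <=
     hnorm (s [*] u n [+] v n [-] (s [*] u k [+] v k))) ->
  ncv X (fun n => s [*] u n [+] v n) l ->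
  exists ub vb, T ub vb /\ s [*] ub [+] vb = l /\ ncv X u ub /\ ncv X v vb.
Proof.
  intros HT Hc Huv Hexp Hl.
  destruct (hcomplete X u) as [ub Hu].
  { intros e He. destruct (Hl (c * e / 2)) as [N HN].
    { assert (0 < c * e) by (apply Rmult_lt_0_compat; lra). lra. }
    exists N. intros n k Hn Hk. change (hnorm (u n [-] u k) < e).
    apply Rmult_lt_reg_l with c; [exact Hc |].
    eapply Rle_lt_trans; [apply Hexp |].
    eapply Rle_lt_trans; [apply norm_sub_triangle with (y := l) |].
    rewrite (norm_sub_sym l). assert (A := HN n Hn). assert (B := HN k Hk). simpl in A, B. lra. }
  change (ncv X u ub) in Hu.
  assert (Hv : ncv X v (l [-] s [*] ub)).
  { assert (H : ncv X (fun n => s [*] u n [+] v n [-] s [*] u n) (l [-] s [*] ub))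
      by (apply ncv_sub; [exact Hl | now apply ncv_scal]).
    intros e He. destruct (H e He) as [N HN]. exists N. intros n Hn. specialize (HN n Hn).
    replace (v n) with (s [*] u n [+] v n [-] s [*] u n) by vec_ring. exact HN. }
  exists ub, (l [-] s [*] ub). repeat split; trivial.
  - now apply (HT u v).
  - vec_ring.
Qed.

(** * Surjectivity of [I + T] and maximality *)

(** At a near-minimizer of [|Y - y|^2], where [Y = u + v] treats both coordinates alike,
    [n = q - 2 (Y - y)] makes [(n, n)] a regular normal. So [n] lies in the coderivative at [- n],
    whence [- |n|^2 >= 0] and [Y - y = q / 2] is as small as wished. *)
Lemma monotone_psd_range {X : Hilbert} (T : setmap X) (y : X) :
  proper X T -> closed_graph X T -> monotone X T -> regular_coderiv_psd X T ->
  exists u, T u (y [-] u).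
Proof.
  intros [u0 [v0 H0]] Hcl Hmon Hpsd.
  (* The factor [1] matches [graph_complete] with [s = 1]. *)
  assert (Hexp : forall u1 v1 u2 v2, T u1 v1 -> T u2 v2 ->
    1 * hnorm (u1 [-] u2) <= hnorm (1 [*] u1 [+] v1 [-] (1 [*] u2 [+] v2))).
  { intros u1 v1 u2 v2 H1 H2. specialize (Hmon _ _ _ _ H1 H2).
    rewrite Rmult_1_l. apply norm_le; [apply norm_nonneg |]. rewrite norm_sqr.
    assert (P := hinner_pos X (v1 [-] v2)).
    replace <<1 [*] u1 [+] v1 [-] (1 [*] u2 [+] v2), 1 [*] u1 [+] v1 [-] (1 [*] u2 [+] v2)>>
      with (<<u1 [-] u2, u1 [-] u2>> + 2 * <<v1 [-] v2, u1 [-] u2>> + <<v1 [-] v2, v1 [-] v2>>)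
      by inner_ring.
    lra. }
  assert (Hclose : forall (a : nat -> X * X) l, (forall n, T (fst (a n)) (snd (a n))) ->
    ncv X (fun n => 1 [*] fst (a n) [+] snd (a n)) l ->
    exists ub vb, T ub vb /\ 1 [*] ub [+] vb = l /\
      ncv X (fun n => fst (a n)) ub /\ ncv X (fun n => snd (a n)) vb).
  { intros a l Ha Hl. apply graph_complete with (c := 1); trivial; [lra |].
    intros n k. now apply Hexp. }
  assert (Happrox : forall e, 0 < e -> exists u v, T u v /\ hnorm (1 [*] u [+] v [-] y) <= e).
  { intros e He.
    destruct (variational_principle (X * X) (fun p => T (fst p) (snd p))
      (fun p => 1 [*] fst p [+] snd p)
      (fun p => <<1 [*] fst p [+] snd p [-] y, 1 [*] fst p [+] snd p [-] y>>) 0 e)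
      as [[u v] [q [Huv [Hq [_ Hopt]]]]]; trivial.
    - exists (u0, v0). exact H0.
    - intros p _. apply hinner_pos.
    - intros a l Ha Hl. destruct (Hclose a l Ha Hl) as [ub [vb [Hb [E _]]]].
      exists (ub, vb). simpl. rewrite E. repeat split; trivial.
      apply inner_cv; (apply ncv_sub; [exact Hl | apply ncv_const]).
    - simpl in *. exists u, v. split; [exact Huv |].
      set (Y := 1 [*] u [+] v) in *.
      set (n := q [-] 2 [*] (Y [-] y)).
      assert (Hn : 0 <= <<n, (-1) [*] n>>).
      { apply (Hpsd u v ((-1) [*] n) n Huv).
        (* The error is [3 |du + dv|^2], one part from the squared distance and two from the
           perturbation, and [|du + dv|^2 <= 2 (|du|^2 + |dv|^2)]. *)
        apply reg_coderiv_of_quadratic with (C := 6) (d := 1); [lra |].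
        intros u' v' Huv' _. specialize (Hopt (u', v') Huv'). simpl in Hopt.
        set (du := u' [-] u). set (dv := v' [-] v).
        replace (1 [*] u' [+] v' [-] y) with ((Y [-] y) [+] (du [+] dv)) in Hopt
          by (unfold Y, du, dv; vec_ring).
        replace (1 [*] u' [+] v' [-] Y) with (du [+] dv) in Hopt
          by (unfold Y, du, dv; vec_ring).
        assert (P := hinner_pos X (du [-] dv)).
        unfold n. revert Hopt P. set (r := Y [-] y).
        repeat progress expand_inner.
        rewrite (hinner_sym X dv du), (hinner_sym X dv r), (hinner_sym X du r). lra. }
      rewrite inner_scal_r in Hn. assert (P := hinner_pos X n).
      assert (Zn : n = hzero) by (apply hinner_def; lra).
      assert (E : Y [-] y = (/2) [*] q).
      { apply inner_ext. intro w. assert (Zw := f_equal (fun x => <<x, w>>) Zn).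
        simpl in Zw. unfold n in Zw. rewrite inner_zero_l, inner_sub_l, hinner_scal_l in Zw.
        rewrite hinner_scal_l. lra. }
      rewrite E, norm_scal, Rabs_pos_eq by lra. generalize (norm_nonneg q). lra. }
  assert (Hseq : forall n, exists p, T (fst p) (snd p) /\
            hnorm (1 [*] fst p [+] snd p [-] y) <= (/2) ^ n).
  { intro n. destruct (Happrox ((/2) ^ n)) as [u H]; [apply pow_lt; lra |].
    destruct H as [v H]. exists (u, v). exact H. }
  destruct (functional_choice _ Hseq) as [a Ha].
  destruct (Hclose a y) as [ub [vb [Hb [E _]]]].
  - intro n. apply Ha.
  - apply ncv_of_bound with (g := fun n => (/2) ^ n); [intro n; apply Ha |].
    apply Un_cv_pow_0. lra.
  - exists ub. replace (y [-] ub) with vb; [exact Hb |]. rewrite <- E. vec_ring.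
Qed.

(** A point [(u, v)] of a monotone extension is compared with the graph point whose coordinates have
    the same sum; there [dv = - du], so monotonicity forces [du = 0]. *)
Lemma monotone_psd_maximal {X : Hilbert} (T : setmap X) :
  proper X T -> closed_graph X T -> monotone X T -> regular_coderiv_psd X T ->
  maximal_monotone X T.
Proof.
  intros Hprop Hcl Hmon Hpsd. split; [exact Hmon |].
  intros S HS Hsub u v Huv.
  destruct (monotone_psd_range T (u [+] v) Hprop Hcl Hmon Hpsd) as [u' Hu'].
  assert (M := HS _ _ _ _ Huv (Hsub _ _ Hu')). assert (P := hinner_pos X (u [-] u')).
  replace (v [-] (u [+] v [-] u')) with ((-1) [*] (u [-] u')) in M by vec_ring.
  rewrite hinner_scal_l in M.
  assert (E : u = u') by (apply sub_eq_zero; lra).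
  subst u'. replace v with (u [+] v [-] u) by vec_ring. exact Hu'.
Qed.

(** * Monotonicity from the coderivative condition *)

(* In the coordinates [Y = s u + v], [N = s u - v], a violation of monotonicity at the pair of
   points says that [G = |dN| > rho = |dY|]. An approximate minimizer over the graph of
   [<g, N> + L |Y - Yb| + k |Y - Yb|^2], where [g = - dN] and [L > G], yields a regular normal
   [(z, - w)] with [z = - s (g + p)], [w = p - g] and [|p| > G = |g|], hence [<z, w> < 0]. For
   large [s] the map [Y |-> N] is nearly nonexpansive on the graph, which keeps the minimizer
   inside the ball where hypomonotonicity is available. *)
Lemma hypomonotone_no_violation {X : Hilbert} (T : setmap X) (u1 v1 u2 v2 : X) (r d th : R) :
  closed_graph X T -> regular_coderiv_psd X T -> 0 < r -> 0 < th ->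
  (forall u v u' v', T u v -> T u' v' -> hnorm (u [-] u2) <= d -> hnorm (u' [-] u2) <= d ->
     - r * <<u [-] u', u [-] u'>> <= <<v [-] v', u [-] u'>>) ->
  T u1 v1 -> T u2 v2 -> 0 < hnorm (u1 [-] u2) -> hnorm (u1 [-] u2) <= d ->
  128 * r * hnorm (u1 [-] u2) < th * d ->
  <<v1 [-] v2, u1 [-] u2>> <= - th * <<u1 [-] u2, u1 [-] u2>> -> False.
Proof.
  intros Hcl Hpsd Hr Hth Hhyp HT1 HT2. set (dl := hnorm (u1 [-] u2)). intros Hdl Hdld Hsmall Hviol.
  (* [2 * r <= s] makes [Y] expanding in [u]; the second bound makes [|dY|] and [|dN|] at most
     [2 * s * dl] for the violating pair. *)
  set (s := Rmax (2 * r) (hnorm (v1 [-] v2) / dl)).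
  assert (Hs2r : 2 * r <= s) by apply Rmax_l.
  assert (Hsv : hnorm (v1 [-] v2) <= s * dl).
  { replace (hnorm (v1 [-] v2)) with (hnorm (v1 [-] v2) / dl * dl) by (field; lra).
    apply Rmult_le_compat_r; [lra | apply Rmax_r]. }
  assert (Hs : 0 < s) by lra.
  clearbody s.
  set (A := fun p : X * X => T (fst p) (snd p) /\ hnorm (fst p [-] u2) <= d).
  set (Y := fun p : X * X => s [*] fst p [+] snd p).
  set (N := fun p : X * X => s [*] fst p [-] snd p).
  set (a := (u1, v1)). set (b := (u2, v2)).
  assert (Ha : A a) by (split; assumption).
  assert (Hb : A b).
  { split; [assumption |]. simpl. replace (u2 [-] u2) with (hzero : X) by vec_ring.
    rewrite norm_zero. lra. }
  assert (Hexp : forall p p', A p -> A p' ->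
    s / 2 * hnorm (fst p [-] fst p') <= hnorm (Y p [-] Y p')).
  { intros [u v] [u' v'] [H1 H2] [H1' H2']. simpl in *.
    assert (H := Hhyp _ _ _ _ H1 H1' H2 H2').
    assert (C := inner_le (Y (u, v) [-] Y (u', v')) (u [-] u')).
    replace <<Y (u, v) [-] Y (u', v'), u [-] u'>>
      with (s * <<u [-] u', u [-] u'>> + <<v [-] v', u [-] u'>>) in C
      by (unfold Y; simpl; inner_ring).
    rewrite <- !norm_sqr in C. rewrite <- norm_sqr in H.
    set (x := hnorm (u [-] u')) in *. assert (Hx : 0 <= x) by apply norm_nonneg.
    destruct Hx as [Hx | Hx].
    - apply Rmult_le_reg_r with x; [exact Hx |].
      assert (0 <= (s - 2 * r) * (x * x)) by (apply Rmult_le_pos; nra). lra.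
    - rewrite <- Hx, Rmult_0_r. apply norm_nonneg. }
  (* In [|dN|^2 = |dY|^2 - 4 s <dv, du>], hypomonotonicity and [Hexp] bound the excess by
     [16 (r / s) |dY|^2]. *)
  assert (HN : forall p p', A p -> A p' ->
    hnorm (N p [-] N p') <= hnorm (Y p [-] Y p') * (1 + 8 * (r / s))).
  { intros p p' Hp Hp'. assert (E := Hexp p p' Hp Hp').
    destruct p as [u v], p' as [u' v'], Hp as [H1 H2], Hp' as [H1' H2']. simpl in *.
    assert (H := Hhyp _ _ _ _ H1 H1' H2 H2').
    assert (Hrs : 0 < r / s) by (apply Rdiv_lt_0_compat; lra).
    assert (Hx := norm_nonneg (u [-] u')). assert (Hy := norm_nonneg (Y (u, v) [-] Y (u', v'))).
    apply norm_le; [apply Rmult_le_pos; lra |].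
    replace <<N (u, v) [-] N (u', v'), N (u, v) [-] N (u', v')>>
      with (<<Y (u, v) [-] Y (u', v'), Y (u, v) [-] Y (u', v')>> - 4 * s * <<v [-] v', u [-] u'>>)
      by (unfold Y, N; simpl; inner_ring).
    rewrite <- norm_sqr. rewrite <- norm_sqr in H.
    set (x := hnorm (u [-] u')) in *. set (y := hnorm (Y (u, v) [-] Y (u', v'))) in *.
    assert (E2 : s / 2 * x * (s / 2 * x) <= y * y) by (apply Rmult_le_compat; nra).
    assert (B : s * (r * (x * x)) <= 4 * (r / s) * (y * y)).
    { replace (s * (r * (x * x))) with (4 * (r / s) * (s / 2 * x * (s / 2 * x))) by (field; lra).
      apply Rmult_le_compat_l; lra. }
    assert (4 * s * (- <<v [-] v', u [-] u'>>) <= 4 * s * (r * (x * x)))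
      by (apply Rmult_le_compat_l; lra).
    assert (0 <= r / s * (r / s) * (y * y)) by (apply Rmult_le_pos; nra).
    nra. }
  set (g := N b [-] N a). set (G := hnorm g). set (rho := hnorm (Y a [-] Y b)).
  assert (Hdl2 : dl * dl = <<u1 [-] u2, u1 [-] u2>>) by apply norm_sqr.
  rewrite <- Hdl2 in Hviol.
  assert (HG2 : 4 * s * (th * (dl * dl)) <= G * G - rho * rho).
  { unfold G, rho. rewrite !norm_sqr.
    replace (<<g, g>> - <<Y a [-] Y b, Y a [-] Y b>>)
      with (4 * s * (- <<v1 [-] v2, u1 [-] u2>>)) by (unfold g, N, Y; simpl; inner_ring).
    apply Rmult_le_compat_l; lra. }
  assert (Hrho : 0 < rho).
  { eapply Rlt_le_trans; [| exact (Hexp a b Ha Hb)]. simpl. fold dl. nra. }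
  assert (HG0 : 0 <= G) by apply norm_nonneg.
  assert (Hrho2 : rho <= 2 * s * dl).
  { unfold rho. replace (Y a [-] Y b) with (s [*] (u1 [-] u2) [+] (v1 [-] v2))
      by (unfold Y; simpl; vec_ring).
    eapply Rle_trans; [apply norm_triangle |]. rewrite norm_scal, Rabs_pos_eq by lra.
    fold dl. lra. }
  assert (HGle : G <= 2 * s * dl).
  { unfold G. replace g with ((- s) [*] (u1 [-] u2) [+] (v1 [-] v2))
      by (unfold g, N; simpl; vec_ring).
    eapply Rle_trans; [apply norm_triangle |]. rewrite norm_scal, Rabs_Ropp, Rabs_pos_eq by lra.
    fold dl. lra. }
  assert (Hgap : th * dl <= G - rho).
  { apply Rmult_le_reg_r with (G + rho); [lra |].
    assert (th * dl * (G + rho) <= th * dl * (4 * s * dl))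
      by (apply Rmult_le_compat_l; [apply Rmult_le_pos; lra | lra]).
    lra. }
  assert (HG : 0 < G) by nra.
  clear HG0.
  assert (Hthdl : 0 < th * dl) by nra.
  set (gap := G - rho) in *.
  (* The excess of [L] over [G] costs [G * gap / 4] at [a] and the quadratic term [G * gap / 2],
     which still leaves [F a = - (G * gap) / 4]. *)
  set (k := G * gap / (2 * (rho * rho))). set (L := G + G * gap / (4 * rho)).
  assert (Hk : 0 < k) by (apply Rdiv_lt_0_compat; nra).
  assert (HLG : 0 < G * gap / (4 * rho)) by (apply Rdiv_lt_0_compat; nra).
  set (c := 8 * (r / s) * G).
  assert (Hc : 0 < c).
  { unfold c. assert (0 < r / s) by (apply Rdiv_lt_0_compat; lra). nra. }
  set (F := fun p => <<g, N p [-] N b>> + L * hnorm (Y p [-] Y b) +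
                     k * <<Y p [-] Y b, Y p [-] Y b>>).
  assert (HF : forall p, A p ->
    k * (hnorm (Y p [-] Y b) * hnorm (Y p [-] Y b)) - c * hnorm (Y p [-] Y b) <= F p).
  { intros p Hp. assert (E := HN p b Hp Hb). unfold F. rewrite <- norm_sqr.
    assert (I := inner_ge g (N p [-] N b)). fold G in I.
    set (y := hnorm (Y p [-] Y b)) in *. assert (Hy : 0 <= y) by apply norm_nonneg.
    assert (G * hnorm (N p [-] N b) <= G * (y * (1 + 8 * (r / s))))
      by (apply Rmult_le_compat_l; lra).
    assert (0 <= G * gap / (4 * rho) * y) by (apply Rmult_le_pos; lra).
    unfold L, c. nra. }
  assert (HFa : F a = - (G * gap) / 4).
  { unfold F. replace <<g, N a [-] N b>> with (- <<g, g>>) by (unfold g; inner_ring).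
    rewrite <- !norm_sqr. fold G rho. unfold L, k, gap. field. lra. }
  (* The first bound keeps [F] negative at the near-minimizer; the second is below [L - G], so the
     perturbation cannot undo [|P| > G]. *)
  set (e := Rmin (G * gap / 8) (G * gap / (8 * rho))).
  assert (He : 0 < e).
  { apply Rmin_glb_lt; apply Rdiv_lt_0_compat; nra. }
  assert (He1 : e <= G * gap / 8) by apply Rmin_l.
  assert (He2 : e < G * gap / (4 * rho)).
  { eapply Rle_lt_trans; [apply Rmin_r |].
    replace (G * gap / (8 * rho)) with (G * gap / (4 * rho) / 2) by (field; lra). lra. }
  destruct (variational_principle (X * X) A Y F (- (c * c) / (4 * k)) e)
    as [[u v] [q [Hp [Hq [Hnear Hopt]]]]]; trivial.
  { exists a. exact Ha. }
  { intros p Hp. eapply Rle_trans; [| exact (HF p Hp)].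
    set (y := hnorm (Y p [-] Y b)). apply Rminus_le.
    replace (- (c * c) / (4 * k) - (k * (y * y) - c * y))
      with (- (k * ((y - c / (2 * k)) * (y - c / (2 * k))))) by (field; lra).
    assert (0 <= k * ((y - c / (2 * k)) * (y - c / (2 * k))))
      by (apply Rmult_le_pos; [lra | apply Rle_0_sqr]).
    lra. }
  { intros p l Hp Hl.
    destruct (graph_complete T s (s / 2) (fun n => fst (p n)) (fun n => snd (p n)) l)
      as [ub [vb [HTb [E [Cu Cv]]]]]; trivial.
    - lra.
    - intro n. apply Hp.
    - intros n m. exact (Hexp _ _ (Hp n) (Hp m)).
    - exists (ub, vb). split; [split; [exact HTb |] | split; [exact E |]].
      + simpl. apply Rle_cv_lim with (Un := fun n => hnorm (fst (p n) [-] u2)) (Vn := fun _ => d).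
        * intro n. apply Hp.
        * apply norm_cv, ncv_sub; [exact Cu | apply ncv_const].
        * apply Un_cv_const.
      + assert (CN : ncv X (fun n => N (p n) [-] N b) (N (ub, vb) [-] N b)).
        { apply ncv_sub; [| apply ncv_const]. unfold N. simpl.
          apply ncv_sub; [now apply ncv_scal | exact Cv]. }
        assert (CY : ncv X (fun n => Y (p n) [-] Y b) (Y (ub, vb) [-] Y b)).
        { apply ncv_sub; [| apply ncv_const]. unfold Y at 2. simpl. rewrite E. exact Hl. }
        unfold F. apply CV_plus; [apply CV_plus |].
        * apply inner_cv; [apply ncv_const | exact CN].
        * apply CV_mult; [apply Un_cv_const | now apply norm_cv].
        * apply CV_mult; [apply Un_cv_const | now apply inner_cv]. }
  set (p := (u, v)) in *.
  set (y := hnorm (Y p [-] Y b)).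
  assert (Hneg : F p < 0).
  { specialize (Hnear a Ha). assert (0 < G * gap) by nra. lra. }
  assert (HFp := HF p Hp). fold y in HFp.
  (* The negative value of [F] excludes [Y p = Y b], where the norm term is not differentiable. *)
  assert (Hy : 0 < y).
  { assert (Hy0 : 0 <= y) by apply norm_nonneg. destruct Hy0 as [|Hy0]; trivial.
    rewrite <- Hy0 in HFp. lra. }
  assert (Hky : k * y < c).
  { apply Rmult_lt_reg_r with y; [exact Hy |]. lra. }
  (* Chaining [s x / 2 <= y < c / k] with the values of [k] and [c] gives [x < 128 r dl / th < d]:
     the minimizer is interior to the ball. *)
  assert (Hin : hnorm (u [-] u2) < d).
  { assert (E := Hexp p b Hp Hb). simpl in E. fold y in E.
    set (x := hnorm (u [-] u2)) in *. assert (Hx : 0 <= x) by apply norm_nonneg.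
    assert (B : s * (k * x) < 2 * c).
    { assert (k * (s / 2 * x) <= k * y) by (apply Rmult_le_compat_l; lra). lra. }
    assert (B2 : s * s * (gap * x) < 32 * r * (rho * rho)).
    { apply Rmult_lt_compat_r with (r := 2 * (rho * rho) * s / G) in B;
        [| apply Rdiv_lt_0_compat; [repeat apply Rmult_lt_0_compat; lra | lra]].
      replace (s * (k * x) * (2 * (rho * rho) * s / G)) with (s * s * (gap * x)) in B
        by (unfold k; field; lra).
      replace (2 * c * (2 * (rho * rho) * s / G)) with (32 * r * (rho * rho)) in B
        by (unfold c; field; lra).
      exact B. }
    assert (rho * rho <= 2 * s * dl * (2 * s * dl)) by (apply Rmult_le_compat; lra).
    assert (B3 : s * s * (gap * x) < s * s * (128 * r * dl * dl)) by nra.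
    apply Rmult_lt_reg_l in B3; [| nra].
    assert (th * dl * x <= gap * x) by (apply Rmult_le_compat_r; lra).
    assert (B4 : th * dl * x < th * dl * d) by nra.
    apply Rmult_lt_reg_l in B4; [exact B4 | exact Hthdl]. }
  (* Gradient in [Y] of the norm and quadratic terms of [F], corrected by [q]. *)
  set (P := (L / y + 2 * k) [*] (Y p [-] Y b) [-] q).
  assert (HLy : 0 < L / y) by (apply Rdiv_lt_0_compat; [unfold L; lra | exact Hy]).
  assert (HP : G < hnorm P).
  { assert (B := norm_triangle P q).
    replace (P [+] q) with ((L / y + 2 * k) [*] (Y p [-] Y b)) in B by (unfold P; vec_ring).
    rewrite norm_scal, Rabs_pos_eq in B by lra. fold y in B.
    replace ((L / y + 2 * k) * y) with (L + 2 * (k * y)) in B by (field; lra).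
    assert (0 < k * y) by (apply Rmult_lt_0_compat; lra). unfold L in B. lra. }
  set (M := 2 + k + L / y / 2).
  assert (Hz : 0 <= <<(- s) [*] (g [+] P), P [-] g>>).
  { apply (Hpsd u v); [apply Hp |].
    apply reg_coderiv_of_quadratic with (C := M * (2 * (s * s + 1))) (d := d - hnorm (u [-] u2));
      [lra |].
    intros u' v' HT' Hnear'.
    assert (Hp' : A (u', v')).
    { split; [exact HT' |]. simpl.
      assert (B := norm_sub_triangle u' u u2). lra. }
    specialize (Hopt _ Hp'). set (p' := (u', v')) in *.
    set (DY := Y p' [-] Y p) in *. set (y' := hnorm (Y p' [-] Y b)).
    assert (E1 : y' * y' = y * y + 2 * <<Y p [-] Y b, DY>> + <<DY, DY>>).
    { unfold y, y'. rewrite !norm_sqr. unfold DY. set (ya := Y p'). set (yb := Y p).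
      set (yc := Y b). inner_ring. }
    (* The tangent bound for the square root replaces the norm by a linear term plus a quadratic
       error. *)
    assert (Hroot : y' - y <= (2 * <<Y p [-] Y b, DY>> + <<DY, DY>>) / (2 * y)).
    { apply Rmult_le_reg_r with (2 * y); [lra |].
      unfold Rdiv. rewrite Rmult_assoc, Rinv_l, Rmult_1_r by lra.
      assert (0 <= (y' - y) * (y' - y)) by apply Rle_0_sqr. lra. }
    assert (HL : 0 < L) by (unfold L; lra).
    apply Rmult_le_compat_l with (r := L) in Hroot; [| lra].
    replace (L * ((2 * <<Y p [-] Y b, DY>> + <<DY, DY>>) / (2 * y)))
      with (L / y * <<Y p [-] Y b, DY>> + L / y / 2 * <<DY, DY>>) in Hroot by (field; lra).
    assert (Hmain : 0 <= <<g, N p' [-] N p>> + <<P, DY>> + M * <<DY, DY>>).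
    { unfold F in Hopt. rewrite <- !(norm_sqr (_ [-] Y b)) in Hopt. fold y y' in Hopt.
      assert (EN : <<g, N p' [-] N b>> = <<g, N p' [-] N p>> + <<g, N p [-] N b>>).
      { set (ya := N p'). set (yb := N p). set (yc := N b). inner_ring. }
      rewrite EN, E1 in Hopt.
      unfold P, M. rewrite inner_sub_l, hinner_scal_l. lra. }
    set (du := u' [-] u) in *. set (dv := v' [-] v).
    assert (EY : DY = s [*] du [+] dv) by (unfold DY, Y, p, p', du, dv; simpl; vec_ring).
    assert (EN : N p' [-] N p = s [*] du [-] dv)
      by (unfold N, p, p', du, dv; simpl; vec_ring).
    rewrite EN, EY in Hmain.
    assert (HM : 0 <= M) by (unfold M; lra).
    assert (Hsz : <<s [*] du [+] dv, s [*] du [+] dv>> <=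
      2 * (s * s + 1) * (<<du, du>> + <<dv, dv>>)).
    { assert (Q := hinner_pos X (s [*] du [-] dv)).
      replace <<s [*] du [-] dv, s [*] du [-] dv>>
        with (2 * (s * s) * <<du, du>> + 2 * <<dv, dv>> -
              <<s [*] du [+] dv, s [*] du [+] dv>>) in Q by inner_ring.
      assert (0 <= s * s * <<dv, dv>>) by (apply Rmult_le_pos; [nra | apply hinner_pos]).
      assert (0 <= <<du, du>>) by apply hinner_pos. lra. }
    apply Rmult_le_compat_l with (r := M) in Hsz; [| exact HM].
    rewrite hinner_scal_l, hinner_add_l, inner_sub_l.
    rewrite inner_sub_r, inner_add_r, !inner_scal_r in Hmain. lra. }
  replace <<(- s) [*] (g [+] P), P [-] g>> with (s * (G * G - <<P, P>>)) in Hz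
    by (unfold G; rewrite norm_sqr; inner_ring).
  rewrite <- norm_sqr in Hz. assert (G * G < hnorm P * hnorm P) by nra. nra.
Qed.

(** * Monotonicity under global and semilocal hypomonotonicity *)

(** Under global hypomonotonicity the radius is free, so it is taken large enough for the smallness
    condition, with [th] the exact rate of the violation. *)
Lemma hypomonotone_psd_monotone {X : Hilbert} (T : setmap X) :
  closed_graph X T -> regular_coderiv_psd X T -> hypomonotone X T -> monotone X T.
Proof.
  intros Hcl Hpsd [r [Hr Hhyp]] u1 v1 u2 v2 H1 H2. apply Rnot_lt_le. intro Hneg.
  assert (Hu : 0 < hnorm (u1 [-] u2)).
  { apply norm_pos. destruct (hinner_pos X (u1 [-] u2)) as [P | P]; trivial.
    symmetry in P. apply hinner_def in P. rewrite P, inner_zero_r in Hneg. lra. }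
  set (dl := hnorm (u1 [-] u2)) in *.
  set (th := - <<v1 [-] v2, u1 [-] u2>> / (dl * dl)).
  assert (Hth : 0 < th) by (apply Rdiv_lt_0_compat; nra).
  assert (Hrth : 0 < r / th) by (apply Rdiv_lt_0_compat; lra).
  apply (hypomonotone_no_violation T u1 v1 u2 v2 r (dl * (128 * (r / th) + 1)) th); trivial.
  - intros u v u' v' HT HT' _ _. specialize (Hhyp _ _ _ _ HT HT').
    rewrite <- norm_sqr. simpl in Hhyp. lra.
  - fold dl. nra.
  - fold dl. replace (th * (dl * (128 * (r / th) + 1))) with (128 * r * dl + th * dl)
      by (field; lra). nra.
  - rewrite <- norm_sqr. fold dl. right. unfold th. field. lra.
Qed.

(** Here the radius is dictated by the point of parameter [t], so the smallness condition is met by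
    taking both points close to it. *)
Lemma semilocally_hypomonotone_segment {X : Hilbert} (T : setmap X) (u1 u2 : X) (t th : R) :
  closed_graph X T -> regular_coderiv_psd X T -> semilocally_hypomonotone X T -> 0 < th ->
  0 < hnorm (u2 [-] u1) -> dom X T ((1 - t) [*] u1 [+] t [*] u2) ->
  exists e, 0 < e /\ forall s1 s2 w1 w2, s1 < s2 -> Rabs (s1 - t) < e -> Rabs (s2 - t) < e ->
    T ((1 - s1) [*] u1 [+] s1 [*] u2) w1 -> T ((1 - s2) [*] u1 [+] s2 [*] u2) w2 ->
    - th * (s2 - s1) * <<u2 [-] u1, u2 [-] u1>> <= <<w2 [-] w1, u2 [-] u1>>.
Proof.
  intros Hcl Hpsd Hsemi Hth. set (D := u2 [-] u1). set (K := hnorm D). intros HK Hdom.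
  set (x := fun s => (1 - s) [*] u1 [+] s [*] u2).
  assert (Hx : forall s s', x s [-] x s' = (s - s') [*] D) by (intros; unfold x, D; vec_ring).
  assert (Hxn : forall s s', hnorm (x s [-] x s') = Rabs (s - s') * K)
    by (intros; rewrite Hx; apply norm_scal).
  destruct (Hsemi _ Hdom) as [d [r [Hd [Hr Hhyp]]]]. fold (x t) in Hhyp.
  (* This value gives both [eta <= d / 4] and [128 * r * (2 * eta) < th * (d / 2)]. *)
  set (eta := d * th / (512 * r + 4 * th)).
  assert (Heta : 0 < eta) by (apply Rdiv_lt_0_compat; nra).
  assert (Eeta : eta * (512 * r + 4 * th) = d * th) by (unfold eta; field; lra).
  assert (Hreta : 0 < r * eta) by nra.
  assert (Hetad : eta <= d / 4) by (apply Rmult_le_reg_r with (4 * th); nra).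
  exists (eta / K). split; [apply Rdiv_lt_0_compat; lra |].
  intros s1 s2 w1 w2 Hs Hs1 Hs2 HT1 HT2. fold (x s1) in HT1. fold (x s2) in HT2.
  assert (scale : forall s, Rabs (s - t) < eta / K -> Rabs (s - t) * K < eta).
  { intros s H. apply Rmult_lt_compat_r with (r := K) in H; [| exact HK].
    replace (eta / K * K) with eta in H by (field; lra). exact H. }
  apply scale in Hs1, Hs2.
  apply Rnot_lt_le. intro Hneg.
  assert (Hdist : hnorm (x s2 [-] x s1) < 2 * eta).
  { eapply Rle_lt_trans; [apply norm_sub_triangle with (y := x t) |].
    rewrite (norm_sub_sym (x t)), !Hxn. lra. }
  apply (hypomonotone_no_violation T (x s2) w2 (x s1) w1 r (d / 2) th); trivial.
  - assert (near : forall u, hnorm (u [-] x s1) <= d / 2 -> hnorm (u [-] x t) < d).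
    { intros u Hu. eapply Rle_lt_trans; [apply norm_sub_triangle with (y := x s1) |].
      rewrite (Hxn s1). lra. }
    intros u v u' v' HT HT' Hu Hu'.
    specialize (Hhyp _ _ _ _ (near _ Hu) (near _ Hu') HT HT').
    rewrite <- norm_sqr. simpl in Hhyp. lra.
  - rewrite Hxn. rewrite Rabs_pos_eq by lra. nra.
  - lra.
  - assert (128 * r * hnorm (x s2 [-] x s1) <= 128 * r * (2 * eta))
      by (apply Rmult_le_compat_l; lra).
    nra.
  - rewrite Hx, hinner_scal_l, !inner_scal_r.
    replace (- th * ((s2 - s1) * ((s2 - s1) * <<D, D>>)))
      with ((s2 - s1) * (- th * (s2 - s1) * <<D, D>>)) by ring.
    apply Rmult_le_compat_l; lra.
Qed.

(** Continuous induction: the losses in the local estimates are proportional to the parameter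
    increments, so they add up, and the local estimate at the supremum [tau] of the parameters
    reached carries past [tau] unless [1] is reached. *)
Lemma semilocally_hypomonotone_psd_monotone {X : Hilbert} (T : setmap X) :
  closed_graph X T -> regular_coderiv_psd X T -> convex X (dom X T) ->
  semilocally_hypomonotone X T -> monotone X T.
Proof.
  intros Hcl Hpsd Hconv Hsemi u2 v2 u1 v1 H2 H1. apply Rnot_lt_le. intro Hneg.
  set (D := u2 [-] u1) in *.
  assert (HD : 0 < <<D, D>>).
  { destruct (hinner_pos X D) as [P | P]; trivial.
    symmetry in P. apply hinner_def in P. rewrite P, inner_zero_r in Hneg. lra. }
  (* Half the rate of the violation: the total loss up to parameter [1] is then too small to account
     for it. *)
  set (th := - <<v2 [-] v1, D>> / (2 * <<D, D>>)).
  assert (Hth : 0 < th) by (apply Rdiv_lt_0_compat; lra).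
  set (x := fun t => (1 - t) [*] u1 [+] t [*] u2).
  assert (Hdom : forall t, 0 <= t <= 1 -> dom X T (x t))
    by (intros t Ht; apply Hconv; [exists v1 | exists v2 |]; trivial).
  assert (Hx0 : x 0 = u1) by (unfold x; vec_ring).
  assert (Hx1 : x 1 = u2) by (unfold x; vec_ring).
  (* The values of [T] at the starting point other than [v1] are irrelevant, whence [t = 0]. *)
  set (E := fun t => 0 <= t <= 1 /\
    (t = 0 \/ forall w, T (x t) w -> - th * t * <<D, D>> <= <<w [-] v1, D>>)).
  assert (E0 : E 0) by (split; [lra | now left]).
  destruct (completeness E) as [tau [Hub Hlub]].
  { exists 1. intros t Ht. apply Ht. }
  { exists 0. exact E0. }
  assert (Htau : 0 <= tau <= 1).
  { split; [now apply Hub | apply Hlub; intros t Ht; apply Ht]. }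
  destruct (semilocally_hypomonotone_segment T u1 u2 tau th) as [e [He Hloc]]; trivial.
  { now apply norm_pos. }
  { now apply Hdom. }
  assert (Ht : exists t, E t /\ tau - e < t).
  { apply NNPP. intro None. assert (tau <= tau - e); [| lra].
    apply Hlub. intros t Et. apply Rnot_lt_le. intro. apply None. exists t. auto. }
  destruct Ht as [t [Et Htt]]. assert (Httau := Hub t Et).
  set (s := Rmin 1 (tau + e / 2)).
  assert (Hs : s = 1 \/ tau < s) by (unfold s, Rmin; destruct (Rle_dec _ _); lra).
  assert (Hs1 : s <= 1) by apply Rmin_l.
  assert (Hs2 : s <= tau + e / 2) by apply Rmin_r.
  assert (E1 : E 1).
  { destruct (Rlt_dec t s) as [Hlt | Hge].
    - assert (Es : E s).
      { destruct Et as [Ht01 Et]. split; [lra |]. right. intros w Hw.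
        assert (Bt : Rabs (t - tau) < e) by (apply Rabs_def1; lra).
        assert (Bs : Rabs (s - tau) < e) by (apply Rabs_def1; lra).
        destruct Et as [-> | Et].
        - rewrite <- Hx0 in H1. assert (L := Hloc 0 s v1 w Hlt Bt Bs H1 Hw).
          rewrite Rminus_0_r in L. exact L.
        - destruct (Hdom t Ht01) as [wt Hwt].
          assert (L := Hloc t s wt w Hlt Bt Bs Hwt Hw). fold D in L. specialize (Et wt Hwt).
          rewrite inner_sub_l in *. lra. }
      assert (Hsl := Hub s Es). destruct Hs as [Hs | Hs]; [now rewrite <- Hs | lra].
    - assert (t = 1) by (destruct Et as [Ht01 _]; lra). now subst t. }
  destruct E1 as [_ [E1 | E1]]; [lra |].
  rewrite <- Hx1 in H2. specialize (E1 v2 H2).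
  replace (- th * 1 * <<D, D>>) with (<<v2 [-] v1, D>> / 2) in E1 by (unfold th; field; lra).
  lra.
Qed.

(** * The two equivalences *)

Lemma monotone_hypomonotone {X : Hilbert} (T : setmap X) : monotone X T -> hypomonotone X T.
Proof.
  intros H. exists 1. split; [lra |]. intros u1 v1 u2 v2 H1 H2. specialize (H _ _ _ _ H1 H2).
  generalize (pow2_ge_0 (hnorm (u1 [-] u2))). lra.
Qed.

Lemma hypomonotone_semilocally {X : Hilbert} (T : setmap X) :
  hypomonotone X T -> semilocally_hypomonotone X T.
Proof.
  intros [r [Hr H]] ub _. exists 1, r. repeat split; try lra. intros. now apply H.
Qed.

Theorem theorem3p7 (X : Hilbert) (T : setmap X) :
  proper X T -> closed_graph X T ->
  (maximal_monotone X T <-> (hypomonotone X T /\ coderiv_psd X T)) /\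
  (convex X (dom X T) ->
    (maximal_monotone X T <-> (semilocally_hypomonotone X T /\ coderiv_psd X T))).
Proof.
  intros Hprop Hcl.
  assert (Hyp : maximal_monotone X T -> hypomonotone X T)
    by (intro HT; apply monotone_hypomonotone, HT).
  assert (Psd : maximal_monotone X T -> coderiv_psd X T)
    by (intro HT; apply coderiv_psd_regular, maximal_monotone_psd; trivial).
  split; [| intro Hconv]; split.
  - auto.
  - intros [Hhyp Hpsd]. apply coderiv_psd_regular in Hpsd.
    apply monotone_psd_maximal; trivial. now apply hypomonotone_psd_monotone.
  - intro HT. split; [apply hypomonotone_semilocally |]; auto.
  - intros [Hsemi Hpsd]. apply coderiv_psd_regular in Hpsd.
    apply monotone_psd_maximal; trivial. now apply semilocally_hypomonotone_psd_monotone.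
Qed.
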